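(* Let $r\ge q\ge 1$ be integers. Let $\mathbf F=(\mathbf f_1,\dots,\mathbf f_q,F_{q+1},\dots,F_r)$, where $\mathbf f_1,\dots,\mathbf f_q$ are weights without isolated vertices and $F_{q+1},\dots,F_r$ are fixed bipartite graphs without isolated vertices. Then there is a constant $M=M(\mathbf F)$, depending only on $\mathbf F$, such that the following holds. For each $i\in[q]$ let $(F_{i,n})_{n\in\mathbb N}$ be a dilatation of $\mathbf f_i$. Then, for all sufficiently large $n$, $$\hat r(\mathbf F)\,n-M(1+f_0)\ \le\ \hat r(F_{1,n},\dots,F_{q,n},F_{q+1},\dots,F_r)\ \le\ \hat r(\mathbf F)\,n+M(1+f_0),$$ where $f_0=f_0(n)=\max\{\,\bigl|\,|F_{i,n}^A|-f_{i,A}n\,\bigr| : i\in[q],\ A\subset V(\mathbf f_i)\}$. In particular, the limit $\lim_{n\to\infty}\hat r(F_{1,n},\dots,F_{q,n},F_{q+1},\dots,F_r)/n$ exists.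
   Context: Notation: $[r]=\{1,\dots,r\}$; $2^X$ is the set of all subsets of $X$; $\subset$ allows equality. All graphs are finite and simple. Size Ramsey number of graphs. For graphs $G,H_1,\dots,H_r$ write $G\to(H_1,\dots,H_r)$ if for every colouring $E(G)\to[r]$ there is $i\in[r]$ such that the graph formed by the edges of colour $i$ contains a copy of $H_i$ as a (not necessarily induced) subgraph. $\hat r(H_1,\dots,H_r)=\min\{e(G): G\to(H_1,\dots,H_r)\}$, where $e(G)$ is the number of edges of $G$. Weights. A weight $\mathbf f$ on a finite nonempty set $V(\mathbf f)$ is a family $(f_A)_{A\in 2^{V(\mathbf f)}}$ of non-negative reals (the entries of $\mathbf f_i$ are denoted $f_{i,A}$). Its order is $v(\mathbf f)=|V(\mathbf f)|$, its size is $e(\mathbf f)=\sum_{A} f_A|A|$, and the degree of $x\in V(\mathbf f)$ is $d(x)=d_{\mathbf f}(x)=\sum_{A\ni x}f_A$. An isolated vertex of a weight (or of a graph) is a vertex of degree $0$. Dilatations. For a bipartite graph $F$ with a fixed bipartition $V(F)=V_1(F)\cup V_2(F)$ and $A\subset V_1(F)$ let $F^A=\{v\in V_2(F): \Gamma_F(v)=A\}$, where $\Gamma_F(v)$ is the neighbourhood of $v$. A sequence $(F_n)_{n\in\mathbb N}$ of bipartite graphs (with fixed bipartitions) is a dilatation of $\mathbf f$ if for every $n$ we have $V_1(F_n)=V(\mathbf f)$ and, for every $A\in 2^{V(\mathbf f)}$, $F_n^A=\emptyset$ if and only if $f_A=0$; and $|F_n^A|=f_An+o(n)$ as $n\to\infty$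 for every $A\in2^{V(\mathbf f)}$. Containment of a graph in a weight. For a bipartite graph $F$ and a weight $\mathbf g$, $F\subset\mathbf g$ means that for some bipartition $V(F)=V_1(F)\cup V_2(F)$ there is an injection $h:V_1(F)\to V(\mathbf g)$ such that for any $A\subset V_1(F)$ dominated by a vertex of $V_2(F)$ (i.e. $A\subset\Gamma_F(y)$ for some $y\in V_2(F)$) there is $B\subset V(\mathbf g)$ with $h(A)\subset B$ and $g_B>0$. Containment of weights. For weights $\mathbf f,\mathbf g$ (if $v(\mathbf f)>v(\mathbf g)$, first enlarge $V(\mathbf g)$ by new vertices, letting $\mathbf g$ be zero on all new sets), $\mathbf f\subset\mathbf g$ means that there are an injection $h:V(\mathbf f)\to V(\mathbf g)$ and reals $w_{AB}\ge0$ ($A\in2^{V(\mathbf f)}$, $B\in2^{V(\mathbf g)}$) such that $w_{AB}=0$ whenever $h(A)\not\subset B$; $\sum_{B\supset h(A)}w_{AB}\ge f_A$ for all $A$; and $\sum_{A:\,h(A)\subset B}w_{AB}\le g_B$ for all $B$. Colourings of weights. An $r$-colouring $\mathbf c$ of a weight $\mathbf g$ is a family $(c_{A_1,\dots,A_r})$ of non-negative reals indexed by $r$-tuples of pairwise disjoint subsets of $V(\mathbf g)$ such that $\sum_{A_1\cup\dots\cup A_r=A}c_{A_1,\dots,A_r}>g_A$ for all $A\in2^{V(\mathbf g)}$. Its $i$-th colour subweight $\mathbf c_i$ is the weight on $V(\mathbf g)$ with $c_{i,A}=\sum_{(A_1,\dots,A_r):\,A_i=A}c_{A_1,\dots,A_r}$.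 Arrowing for weights. For $\mathbf F=(\mathbf F_1,\dots,\mathbf F_r)$, with $\mathbf F_i$ a weight for $i\le q$ and a bipartite graph for $i>q$, none having an isolated vertex, $\mathbf g\to\mathbf F$ means that for every $r$-colouring $\mathbf c$ of $\mathbf g$ we have $\mathbf F_i\subset\mathbf c_i$ for some $i\in[r]$. Finally $\hat r(\mathbf F)=\inf\{e(\mathbf g):\mathbf g\text{ is a weight},\ \mathbf g\to\mathbf F\}$. *)

(* Defs.v *)
(* MathComp / MathComp-Analysis *)
From HB Require Import structures.
From mathcomp Require Import all_boot all_order all_algebra.
From mathcomp Require Import boolp classical_sets reals ereal topology.
From mathcomp Require Import normedtype sequences landau.

Set Implicit Arguments.
Unset Strict Implicit.
Unset Printing Implicit Defensive.

Import Order.TTheory GRing.Theory Num.Theory.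
Import numFieldNormedType.Exports.
Local Open Scope ring_scope.

Record sgraph := SGraph {
  gvert :> finType;
  gedge : rel gvert;
  gedge_sym : symmetric gedge;
  gedge_irrefl : irreflexive gedge }.

Definition gnbr (G : sgraph) (x : G) : {set G} := [set y | gedge x y].

Definition g_no_isolated (G : sgraph) := forall x : G, #|gnbr x| != 0%N.

Definition gedges (G : sgraph) : {set {set G}} :=
  [set [set p.1; p.2] | p : G * G & gedge p.1 p.2].

Definition gsize (G : sgraph) : nat := #|gedges G|.

(* [V1] is one of the two classes; the other one is its complement. *)
Definition bipartition (G : sgraph) (V1 : {set G}) :=
  forall x y : G, gedge x y -> (x \in V1) != (y \in V1).

Definition bipartite (G : sgraph) := exists V1 : {set G}, bipartition V1.

Definition gcopy (H G : sgraph) :=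
  exists h : H -> G, injective h /\
    forall x y : H, gedge x y -> gedge (h x) (h y).

(* An edge colouring is given on all vertex sets; its values on non-edges
   are never used. *)
Section ColourClass.
Variables (r : nat) (G : sgraph) (c : {set G} -> 'I_r) (i : 'I_r).

Definition cclass_edge : rel G :=
  [rel x y | gedge x y && (c [set x; y] == i)].

Lemma cclass_sym : symmetric cclass_edge.
Proof. by move=> x y; rewrite /cclass_edge /= gedge_sym finset.setUC. Qed.

Lemma cclass_irrefl : irreflexive cclass_edge.
Proof. by move=> x; rewrite /cclass_edge /= gedge_irrefl. Qed.

Definition cclass : sgraph := SGraph cclass_sym cclass_irrefl.
End ColourClass.

Definition garrows (r : nat) (G : sgraph) (H : 'I_r -> sgraph) :=
  forall c : {set G} -> 'I_r, exists i : 'I_r, gcopy (H i) (cclass c i).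

(* The minimum exists by Ramsey's theorem; the default value 0 of [xget]
   is never used. *)
Definition size_ramsey (r : nat) (H : 'I_r -> sgraph) : nat :=
  xget 0%N (fun m : nat =>
    (exists2 G : sgraph, garrows G H & gsize G = m) /\
    (forall G : sgraph, garrows G H -> (m <= gsize G)%N)).

Record bigraph (V1 : finType) := BiGraph {
  bvert2 : finType;
  badj : V1 -> bvert2 -> bool }.

Definition bpart (V1 : finType) (F : bigraph V1) (A : {set V1}) :
    {set bvert2 F} :=
  [set v | [set x | badj x v] == A].

Section UnderlyingGraph.
Variables (V1 : finType) (F : bigraph V1).

Definition bg_edge : rel (V1 + bvert2 F)%type := fun u v =>
  match u, v with
  | inl x, inr y | inr y, inl x => badj x y
  | _, _ => false
  end.

Lemma bg_edge_sym : symmetric bg_edge.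
Proof. by case=> x [] y. Qed.

Lemma bg_edge_irrefl : irreflexive bg_edge.
Proof. by case. Qed.

Definition bg_graph : sgraph := SGraph bg_edge_sym bg_edge_irrefl.
End UnderlyingGraph.

Record weight (R : realType) := Weight {
  wvert : finType;
  wval :> {set wvert} -> R;
  wvert_gt0 : (0 < #|wvert|)%N;
  wval_ge0 : forall A, 0 <= wval A }.

Section Weights.
Variable R : realType.
Implicit Types f g : weight R.

Definition worder f : nat := #|wvert f|.

Definition wsize f : R := \sum_(A : {set wvert f}) f A * #|A|%:R.

Definition wdeg f (x : wvert f) : R := \sum_(A : {set wvert f} | x \in A) f A.

Definition w_no_isolated f := forall x : wvert f, wdeg x != 0.

Definition dilatation f (F : nat -> bigraph (wvert f)) :=
  (forall n (A : {set wvert f}), bpart (F n) A = finset.set0 <-> f A = 0) /\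
  (forall A : {set wvert f},
     ((fun n : nat => #|bpart (F n) A|%:R - f A * n%:R : R^o)
        =o_\oo (fun n : nat => n%:R : R^o))%classic).

Definition graph_in_weight (F : sgraph) g :=
  exists V1 : {set F}, bipartition V1 /\
  exists h : F -> wvert g, {in V1 &, injective h} /\
  forall A : {set F}, A \subset V1 ->
    (exists2 y : F, y \notin V1 & A \subset gnbr y) ->
    exists B : {set wvert g}, h @: A \subset B /\ 0 < g B.

(* [wpad g k] is [g] on a vertex set enlarged by [k] new vertices. *)
Section Pad.
Variables (g : weight R) (k : nat).

Definition wpad_val (B : {set (wvert g + 'I_k)%type}) : R :=
  if [exists j : 'I_k, inr j \in B] then 0 else g [set x | inl x \in B].

Lemma wpad_gt0 : (0 < #|{: wvert g + 'I_k}|)%N.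
Proof. by rewrite card_sum addn_gt0 wvert_gt0. Qed.

Lemma wpad_ge0 B : 0 <= wpad_val B.
Proof. by rewrite /wpad_val; case: ifP => // _; exact: wval_ge0. Qed.

Definition wpad : weight R := Weight wpad_gt0 wpad_ge0.
End Pad.

Definition wembed f g :=
  exists (h : wvert f -> wvert g) (w : {set wvert f} -> {set wvert g} -> R),
  [/\ injective h,
      forall (A : {set wvert f}) (B : {set wvert g}), 0 <= w A B,
      forall (A : {set wvert f}) (B : {set wvert g}),
        ~~ (h @: A \subset B) -> w A B = 0,
      forall A : {set wvert f},
        f A <= \sum_(B : {set wvert g} | h @: A \subset B) w A B
    & forall B : {set wvert g},
        \sum_(A : {set wvert f} | h @: A \subset B) w A B <= g B].

(* Truncated subtraction: nothing is added when [worder f <= worder g]. *)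
Definition weight_in_weight f g := wembed f (wpad g (worder f - worder g)).

Definition disjoint_tuple (r : nat) (V : finType) : predArgType :=
  {S : {ffun 'I_r -> {set V}} |
    [forall i, forall j, (i != j) ==> [disjoint S i & S j]]}.

Record wcolouring (r : nat) (g : weight R) := WColouring {
  wcol :> disjoint_tuple r (wvert g) -> R;
  wcol_ge0 : forall S, 0 <= wcol S;
  wcol_gt : forall A : {set wvert g},
    g A < \sum_(S : disjoint_tuple r (wvert g)
                  | (\bigcup_(i < r) val S i)%SET == A) wcol S }.

Section SubWeight.
Variables (r : nat) (g : weight R) (c : wcolouring r g) (i : 'I_r).

Definition csub_val (A : {set wvert g}) : R :=
  \sum_(S : disjoint_tuple r (wvert g) | val S i == A) c S.

Lemma csub_ge0 A : 0 <= csub_val A.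
Proof. by apply: sumr_ge0 => S _; exact: wcol_ge0. Qed.

Definition csub : weight R := Weight (wvert_gt0 g) csub_ge0.
End SubWeight.

Definition target_in (F : weight R + sgraph) g :=
  match F with
  | inl f => weight_in_weight f g
  | inr H => graph_in_weight H g
  end.

Definition warrows (r : nat) g (F : 'I_r -> weight R + sgraph) :=
  forall c : wcolouring r g, exists i : 'I_r, target_in (F i) (csub c i).

Definition wramsey (r : nat) (F : 'I_r -> weight R + sgraph) : \bar R :=
  ereal_inf (fun s : \bar R =>
    exists2 g : weight R, warrows g F & s = (wsize g)%:E).

Definition dil_error (q : nat) (f : 'I_q -> weight R)
    (F : forall i : 'I_q, nat -> bigraph (wvert (f i))) (n : nat) : R :=
  \big[Num.max/0]_(i < q) \big[Num.max/0]_(A : {set wvert (f i)})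
    `| #|bpart (F i n) A|%:R - f i A * n%:R |.
End Weights.

(* The sequence (a_1, ..., a_q, b_1, ..., b_(r-q)). *)
Definition famcat (T : Type) (r q : nat) (hqr : (q <= r)%N)
    (a : 'I_q -> T) (b : 'I_(r - q) -> T) (i : 'I_r) : T :=
  match split (cast_ord (esym (subnKC hqr)) i) with
  | inl j => a j
  | inr k => b k
  end.

(* Main.v *)
Require Import Defs.
From mathcomp Require Import all_boot all_order all_algebra.
From mathcomp Require Import boolp classical_sets reals ereal topology.
From mathcomp Require Import normedtype sequences landau.
From mathcomp Require Import lra.
Import Order.TTheory GRing.Theory Num.Theory.
Import numFieldNormedType.Exports.
Local Open Scope ring_scope.

(** Weights and graphs are translated into each other at scale [n], each
    translation costing an additive error [O(1 + f_0)].

    From a weight [g] to a graph: join about [g_A n] new vertices to each set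
    [A] of vertices of [g].  A colouring of this graph splits the neighbourhood
    of every new vertex into colour classes; counting the new vertices with a
    given splitting gives a colouring of [g], and a target contained in one of
    its colours is turned into a copy of the target graph by rounding the
    transportation plan to an integral one.

    From an arrowing graph [G] with at most [C n] edges to a weight: only
    vertices of degree at least [d n] can play the role of a vertex of a weight
    [f_i], and the set [L] of these has bounded size.  The weight counts the
    vertices outside [L] according to their neighbourhood in [L].  A colouring
    of it is transferred to the edges between [L] and its complement; all other
    edges get the colour of a weight target, for which they are harmless because
    there are few vertices in [L] and those outside have too small a degree.

    Passing from a nearly optimal weight to a graph and back shows that nearly
    optimal weights can be taken on a bounded number of vertices, which makes
    the error in the upper bound uniform. *)

(** * Injections with prescribed marginals *)

(** An element of [X] goes to the element of [Y] at the same position among those with its label;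
    the cardinality bound ensures that this position exists. *)
Lemma label_injection {X Y I : finType} (a : X -> I) (b : Y -> I) :
  (forall i, #|[pred x | a x == i]| <= #|[pred y | b y == i]|)%N ->
  exists phi : X -> Y, injective phi /\ forall x, b (phi x) = a x.
Proof.
move=> hab.
have [y0|Y0] := pickP (@predT Y); last first.
  have X0 (x : X) : False.
    have := hab (a x); have -> : #|[pred y | b y == a x]| = 0%N.
      by apply: eq_card0 => y; have := Y0 y.
    by rewrite leqn0 => /eqP/card0_eq/(_ x); rewrite !inE eqxx.
  by exists (fun x => False_rect Y (X0 x)); split=> [x|x]; case: (X0 x).
move=> _.
pose ex i := enum [pred x | a x == i]; pose ey i := enum [pred y | b y == i].
have lt_ix x : (index x (ex (a x)) < size (ey (a x)))%N.
  rewrite -cardE (leq_trans _ (hab _)) // cardE index_mem mem_enum.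
  by rewrite inE.
pose phi x := nth y0 (ey (a x)) (index x (ex (a x))).
have phiE x : b (phi x) = a x.
  have : phi x \in ey (a x) by rewrite mem_nth.
  by rewrite mem_enum inE => /eqP.
exists phi; split=> // x x' eq_phi.
have eq_a : a x = a x' by rewrite -!phiE eq_phi.
move: eq_phi; rewrite /phi -eq_a => /eqP.
rewrite nth_uniq ?enum_uniq // => [/eqP eqi|]; last by rewrite eq_a.
have memx z : a z = a x -> z \in ex (a x).
  by move=> az; rewrite mem_enum inE az.
by rewrite -(nth_index x (memx x erefl)) eqi nth_index // memx.
Qed.

Lemma card_sum_label {I : finType} (J : I -> finType) (P : pred I) :
  #|[pred s : {i : I & J i} | P (tag s)]| = (\sum_(i | P i) #|J i|)%N.
Proof.
rewrite -sum1_card; under [RHS]eq_bigr do rewrite -sum1_card.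
by rewrite sig_big_dep /=; apply: eq_bigl => s; rewrite !inE andbT.
Qed.

(* A transportation plan [m] with integral entries is realised by an injection:
   both marginals are compared with the intermediate set of units of [m]. *)
Lemma transport {X Y I J : finType} (a : X -> I) (b : Y -> J)
    (m : I -> J -> nat) :
  (forall i, #|[pred x | a x == i]| <= \sum_j m i j)%N ->
  (forall j, \sum_i m i j <= #|[pred y | b y == j]|)%N ->
  exists phi : X -> Y, injective phi /\ forall x, (0 < m (a x) (b (phi x)))%N.
Proof.
move=> ha hb.
pose U := {p : I * J & 'I_(m p.1 p.2)}.
have card_U (P : pred (I * J)) :
    #|[pred s : U | P (tag s)]| = (\sum_(p | P p) m p.1 p.2)%N.
  by rewrite (card_sum_label _ P); apply: eq_bigr => p _; rewrite card_ord.
have [i|f [f_inj fE]] := @label_injection X U I a (fun s => (tag s).1).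
  rewrite (card_U (fun p => p.1 == i)); apply: leq_trans (ha i) _.
  have -> : (\sum_(p : I * J | p.1 == i) m p.1 p.2 =
             \sum_(i' | i' == i) \sum_j m i' j)%N.
    by rewrite pair_big /=; apply: eq_bigl => p; rewrite andbT.
  by rewrite big_pred1_eq.
have [j|g [g_inj gE]] := @label_injection U Y J (fun s => (tag s).2) b.
  rewrite (card_U (fun p => p.2 == j)); apply: leq_trans (hb j).
  have -> : (\sum_(p : I * J | p.2 == j) m p.1 p.2 =
             \sum_i \sum_(j' | j' == j) m i j')%N by rewrite pair_big.
  by apply: leq_sum => i _; rewrite big_pred1_eq.
exists (g \o f); split=> [|x /=]; first exact: inj_comp.
rewrite gE -(fE x); case: (f x) => -[i j] k.
exact: leq_ltn_trans (ltn_ord k).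
Qed.

(** * Weights and graphs *)

Lemma sum_card_fibre {Y J : finType} (t : Y -> J) (P : pred J) :
  (\sum_(j | P j) #|[pred y | t y == j]| = #|[pred y | P (t y)]|)%N.
Proof.
rewrite -[RHS]sum1_card (partition_big t P) //=.
by apply: eq_bigr => j Pj; rewrite -sum1_card; apply: eq_bigl => y;
  rewrite !inE; case: eqP => [->|_]; rewrite ?Pj ?andbF.
Qed.

Lemma psumr_gt0_ex {R : realType} {I : finType} (P : pred I) (u : I -> R) :
  0 < \sum_(i | P i) u i -> exists2 i, P i & 0 < u i.
Proof.
move=> u_gt0; apply: contrapT => u_le0; move: u_gt0; rewrite ltNge sumr_le0 //.
by move=> i Pi; rewrite leNgt; apply/negP => ui; apply: u_le0; exists i.
Qed.

Lemma ler_term_sum {R : realType} {I : finType} (P : pred I) (u : I -> R) j :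
  P j -> (forall i, 0 <= u i) -> u j <= \sum_(i | P i) u i.
Proof. by move=> Pj u0; rewrite (bigD1 j) //= lerDl sumr_ge0. Qed.

Lemma wembed_unpadded {R : realType} {f g : weight R} :
  w_no_isolated f -> weight_in_weight f g ->
  exists (h : wvert f -> wvert g) (w : {set wvert f} -> {set wvert g} -> R),
  [/\ injective h,
      forall A B, 0 <= w A B,
      forall (A : {set wvert f}) (B : {set wvert g}),
        0 < w A B -> h @: A \subset B,
      forall A : {set wvert f}, f A <= \sum_B w A B
    & forall B : {set wvert g}, \sum_A w A B <= g B].
Proof.
pose PV := {set wvert (wpad g (worder f - worder g))}.
move=> f_iso [h0 [w0 [h0_inj w0_ge0 w0_sub f_le g_ge]]].
have supp A (B : PV) : 0 < w0 A B -> h0 @: A \subset B.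
  by apply: contraTT => /w0_sub ->; rewrite ltxx.
have sumf (A : {set wvert f}) :
    \sum_(B : PV | h0 @: A \subset B) w0 A B = \sum_B w0 A B.
  rewrite [RHS](bigID (fun B : PV => h0 @: A \subset B)) /=.
  by rewrite [X in _ = _ + X]big1 ?addr0 // => B /w0_sub.
have sumg (B : PV) :
    \sum_(A : {set wvert f} | h0 @: A \subset B) w0 A B = \sum_A w0 A B.
  rewrite [RHS](bigID (fun A : {set wvert f} => h0 @: A \subset B)) /=.
  by rewrite [X in _ = _ + X]big1 ?addr0 // => A /w0_sub.
have pad0 A (B : PV) j : inr j \in B -> w0 A B = 0.
  move=> jB; apply/eqP; rewrite eq_le w0_ge0 andbT.
  apply: le_trans (_ : \sum_A w0 A B <= _).
    by rewrite (bigD1 A) //= lerDl sumr_ge0.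
  rewrite -sumg; apply: le_trans (g_ge B) _.
  by rewrite /= /wpad_val; case: existsP => // -[]; exists j.
have h0_inl x : exists z, h0 x = inl z.
  have [A xA fA] : exists2 A : {set wvert f}, x \in A & 0 < f A.
    apply: psumr_gt0_ex; rewrite lt_def; apply/andP; split; first exact: f_iso.
    by apply: sumr_ge0 => A _; exact: wval_ge0.
  have [B _ wAB] : exists2 B, true & 0 < w0 A B.
    by apply: psumr_gt0_ex; rewrite -sumf; exact: lt_le_trans fA (f_le A).
  have : h0 x \in B by apply: (fintype.subsetP (supp _ _ wAB)); exact: imset_f.
  case: (h0 x) => [z|j] xB; first by exists z.
  by move: wAB; rewrite (pad0 _ _ _ xB) ltxx.
pose h x := sval (cid (h0_inl x)).
have hE x : h0 x = inl (h x) by rewrite /h; case: cid.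
pose up (B : {set wvert g}) : PV := inl @: B.
have inl_inj : injective (@inl (wvert g) 'I_(worder f - worder g)).
  by move=> x y [].
have upE B x : (inl x \in up B) = (x \in B) by rewrite mem_imset.
have up_inr B j : (inr j \in up B) = false.
  by apply/negP => /imsetP[].
exists h, (fun A B => w0 A (up B)); split=> [x y|A B|A B|A|B].
- by move=> hxy; apply: h0_inj; rewrite !hE hxy.
- exact: w0_ge0.
- move=> /supp/fintype.subsetP hAB; apply/fintype.subsetP => _ /imsetP[x xA ->].
  by rewrite -upE -hE; apply: hAB; exact: imset_f.
- apply: le_trans (f_le A) _; rewrite sumf.
  rewrite (bigID (fun B : PV => [exists j, inr j \in B])) /=.
  rewrite big1 ?add0r; last first.
    by move=> B /existsP[j /pad0].
  rewrite (reindex_onto up (fun B => [set x | inl x \in B])) /=; last first.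
    move=> B /existsPn B_inr; apply/setP => -[x|j].
      by rewrite upE inE.
    by rewrite up_inr; apply/esym/negbTE/B_inr.
  rewrite le_eqVlt; apply/orP; left; apply/eqP; apply: eq_bigl => B.
  apply/andP; split; first by apply/existsPn => j; rewrite up_inr.
  by apply/eqP/setP => x; rewrite inE upE.
- rewrite -sumg; apply: le_trans (g_ge _) _; rewrite /= /wpad_val.
  case: existsP => [_|_]; first exact: wval_ge0.
  by rewrite le_eqVlt; apply/orP; left; apply/eqP; congr (g _); apply/setP => x;
    rewrite inE upE.
Qed.

(** Converse direction: the plan is extended by zero to the sets that meet the padding. *)
Lemma wembed_padded {R : realType} {f g : weight R} (h : wvert f -> wvert g)
    (w : {set wvert f} -> {set wvert g} -> R) :
  injective h -> (forall A B, 0 <= w A B) ->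
  (forall (A : {set wvert f}) (B : {set wvert g}),
     0 < w A B -> h @: A \subset B) ->
  (forall A : {set wvert f}, f A <= \sum_B w A B) ->
  (forall B : {set wvert g}, \sum_A w A B <= g B) ->
  weight_in_weight f g.
Proof.
move=> h_inj w_ge0 w_sub fw wg.
pose k := (worder f - worder g)%N.
pose down (B : {set wvert g + 'I_k}) : {set wvert g} := [set x | inl x \in B].
pose padded (B : {set wvert g + 'I_k}) := [exists j, inr j \in B].
pose w0 (A : {set wvert f}) (B : {set wvert g + 'I_k}) :=
  if padded B then 0 else w A (down B).
pose h0 (x : wvert f) : wvert g + 'I_k := inl (h x).
have w0_sub (A : {set wvert f}) (B : {set wvert g + 'I_k}) :
    ~~ (h0 @: A \subset B) -> w0 A B = 0.
  rewrite /w0; case: ifP => // _ hAB; apply/eqP; rewrite eq_le w_ge0 andbT.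
  rewrite leNgt; apply: contra hAB => /w_sub/fintype.subsetP hAB.
  apply/fintype.subsetP => _ /imsetP[x xA ->].
  by have := hAB _ (imset_f h xA); rewrite inE.
exists h0, w0; split=> [x y [] /h_inj //|A B|//|A|B].
- by rewrite /w0; case: ifP.
- rewrite big_mkcond /=; apply: le_trans (fw A) _.
  rewrite [leRHS](_ : _ = \sum_B w0 A B); last first.
    by apply: eq_bigr => B _; case: ifP => // /negbT/w0_sub.
  rewrite [leRHS](bigID (fun B => ~~ padded B)) /=.
  rewrite [X in _ + X]big1 ?addr0; last first.
    by move=> B; rewrite negbK /w0 => ->.
  rewrite (reindex_onto (fun B : {set wvert g} => inl @: B) down) /=;
    last first.
    move=> B /existsPn B_inr; apply/setP => -[x|j].
      by rewrite mem_imset ?inE // => ? ? [].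
    by rewrite (negbTE (B_inr j)); apply/negbTE/negP => /imsetP[].
  have npad (B : {set wvert g}) : padded (inl @: B) = false.
    by apply/existsP => -[j /imsetP[]].
  have downK (B : {set wvert g}) : down (inl @: B) = B.
    by apply/setP => x; rewrite inE mem_imset // => ? ? [].
  rewrite le_eqVlt; apply/orP; left; apply/eqP; apply: eq_big => B.
    by rewrite npad downK eqxx.
  by rewrite /w0 npad downK.
- rewrite big_mkcond /= (eq_bigr (fun A => w0 A B)); last first.
    by move=> A _; case: ifP => // /negbT/w0_sub.
  rewrite /w0 /wpad_val -/(padded B); case: (padded B) => /=; last exact: wg.
  by rewrite big1.
Qed.

(** * Blow-ups, splittings of neighbourhoods and edge counts *)

Lemma gsize_bg_graph {V : finType} (B : bigraph V) :
  (gsize (bg_graph B) <= \sum_(y : bvert2 B) #|[set x | badj x y]|)%N.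
Proof.
pose P := [set p : V * bvert2 B | badj p.1 p.2].
pose e (p : V * bvert2 B) : {set bg_graph B} := [set inl p.1; inr p.2].
apply: (@leq_trans #|e @: P|).
  apply: subset_leq_card; apply/fintype.subsetP => _ /imsetP[[u v] + ->].
  rewrite inE /=; case: u v => [x|y] [x'|y'] //= xy.
    by apply/imsetP; exists (x, y'); rewrite ?inE.
  by apply/imsetP; exists (x', y); rewrite ?inE //= finset.setUC.
apply: leq_trans (leq_imset_card _ _) _; rewrite -sum1_card.
rewrite (eq_bigl (fun p : V * bvert2 B => predT p.1 && badj p.1 p.2));
  last first.
  by move=> p; rewrite inE.
rewrite -(pair_big_dep predT (fun x y => badj x y) (fun _ _ => 1%N)) /=.
rewrite (exchange_big_dep predT) //=; apply: leq_sum => y _.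
by rewrite -sum1_card; apply: eq_leq; apply: eq_bigl => x; rewrite inE.
Qed.

Definition blowup {V : finType} (s : {set V} -> nat) : bigraph V :=
  @BiGraph V {A : {set V} & 'I_(s A)} (fun x y => x \in tag y).

Lemma gsize_blowup {V : finType} (s : {set V} -> nat) :
  (gsize (bg_graph (blowup s)) <= \sum_A s A * #|A|)%N.
Proof.
apply: leq_trans (gsize_bg_graph _) _.
rewrite (eq_bigr (fun y : bvert2 (blowup s) => #|tag y|)); last first.
  by move=> y _; apply: eq_card => x; rewrite inE.
have -> : (\sum_(y : bvert2 (blowup s)) #|tag y| =
           \sum_A \sum_(k < s A) #|A|)%N by rewrite sig_big_dep.
by apply: leq_sum => A _; rewrite sum_nat_const card_ord.
Qed.

Section SplitTuple.
Context {r : nat} {V : finType} (N : {set V}) (k : V -> 'I_r).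

Lemma split_tuple_subproof :
  [forall i, forall j, (i != j) ==>
    [disjoint [ffun i => [set x in N | k x == i]] i
            & [ffun i => [set x in N | k x == i]] j]].
Proof.
apply/forallP => i; apply/forallP => j; apply/implyP => ij.
rewrite !ffunE -setI_eq0; apply/eqP/setP => x; rewrite !inE.
case: (x \in N) => //=; case: eqP => //= ->; exact: negbTE.
Qed.

(** With [N] the neighbourhood of a new vertex and [k] the colours of its edges, this is the index
    at which the vertex is counted in a weight colouring. *)
Definition split_tuple : disjoint_tuple r V :=
  exist (fun S : {ffun 'I_r -> {set V}} =>
    [forall i, forall j, (i != j) ==> [disjoint S i & S j]] : Prop)
    [ffun i => [set x in N | k x == i]] split_tuple_subproof.

Lemma split_tupleE i x : (x \in val split_tuple i) = (x \in N) && (k x == i).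
Proof. by rewrite ffunE inE. Qed.

Lemma split_tuple_cup : (\bigcup_(i < r) val split_tuple i)%SET = N.
Proof.
apply/setP => x; apply/bigcupP/idP => [[i _]|xN].
  by rewrite split_tupleE => /andP[].
by exists (k x); rewrite // split_tupleE xN eqxx.
Qed.
End SplitTuple.

(** Double counting of incidences: distinct neighbours of [x] give distinct edges at [x], and an
    edge has at most two ends. *)
Lemma sum_card_gnbr (G : sgraph) :
  (\sum_(x : G) #|gnbr x| <= 2 * gsize G)%N.
Proof.
apply: (@leq_trans (\sum_(x : G) \sum_(E in gedges G) (x \in E))%N).
  apply: leq_sum => x _; rewrite -big_mkcondr sum1_card.
  have pair_inj : {in gnbr x &, injective (fun y => [set x; y])}.
    move=> y z; rewrite !inE => xy xz eq_yz.
    have : y \in [set x; z] by rewrite -eq_yz set22.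
    by rewrite !inE => /orP[] /eqP // yx; rewrite yx gedge_irrefl in xy.
  rewrite -(card_in_imset pair_inj); apply: subset_leq_card.
  apply/fintype.subsetP => _ /imsetP[y + ->]; rewrite inE => xy.
  rewrite unfold_in /= !inE eqxx andbT.
  by apply/imsetP; exists (x, y); rewrite ?inE.
rewrite exchange_big /= mulnC -sum_nat_const; apply: leq_sum => E.
move=> /imsetP[[x y] _ ->] /=; rewrite -big_mkcond sum1_card.
by rewrite cards2; case: (x != y).
Qed.

Lemma card_all_sets (V : finType) : #|{: {set V}}| = (2 ^ #|V|)%N.
Proof. by rewrite -[in RHS]cardsT -card_powerset powersetT cardsT. Qed.

Lemma sum_const_sets {R : realType} (V : finType) (x : R) :
  \sum_(A : {set V}) x = (2 ^ #|V|)%:R * x.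
Proof.
by rewrite sumr_const (_ : #|_| = 2 ^ #|V|)%N ?mulr_natl // -card_all_sets.
Qed.

(** * From weights to graphs *)

(** Treats both kinds of target at once. For a weight, [H] is a possible term of a dilatation at
    scale [n], and [e] bounds the errors of all its classes. *)
Definition realizes {R : realType} (n : nat) (e : R) (T : weight R + sgraph)
    (H : sgraph) : Prop :=
  match T with
  | inl f => exists2 B : bigraph (wvert f), H = bg_graph B &
      forall A, (bpart B A = finset.set0 <-> f A = 0) /\
        `| #|bpart B A|%:R - f A * n%:R | <= e
  | inr F => H = F
  end.

(** For a weight the number of vertex sets is bounded, since each of them can cause one rounding
    error. *)
Definition target_bound {R : realType} (K : nat) (T : weight R + sgraph) :=
  match T with
  | inl f => (2 ^ #|wvert f| <= K)%N
  | inr F => (#|F| <= K)%N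
  end.

Definition target_nondeg {R : realType} (T : weight R + sgraph) : Prop :=
  if T is inl f then w_no_isolated f else True.

Lemma card_disjoint_tuple {r : nat} {V : finType} {l : nat} :
  (#|V| <= l)%N -> (#|{: disjoint_tuple r V}| <= (2 ^ l) ^ r)%N.
Proof.
move=> Vl; rewrite card_sig; apply: leq_trans (max_card _) _.
rewrite card_ffun card_ord card_all_sets.
have le2 : (2 ^ #|V| <= 2 ^ l)%N by rewrite leq_pexp2l.
by elim: r => // k IHk; rewrite !expnS leq_mul.
Qed.

(* The slack [K] absorbs the rounding: a splitting seen on at most [K]
   vertices gets weight 0, so positive weight always means at least [K]
   vertices. *)
Section WeightToGraph.
Context {R : realType} {r : nat} {g : weight R} {n : nat} {K : R}.
Hypotheses (n_gt0 : (0 < n)%N) (K_ge0 : 0 <= K).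
Variable s : {set wvert g} -> nat.
Hypothesis s_gt : forall A,
  g A * n%:R + #|{: disjoint_tuple r (wvert g)}|%:R * K < (s A)%:R.
Let G := bg_graph (blowup s).
Variable chi : {set G} -> 'I_r.

Definition vertex_tuple (y : bvert2 (blowup s)) : disjoint_tuple r (wvert g) :=
  split_tuple (tag y) (fun x => chi [set inl x; inr y]).

Let N (S : disjoint_tuple r (wvert g)) := #|[pred y | vertex_tuple y == S]|.

Definition induced_col (S : disjoint_tuple r (wvert g)) : R :=
  Num.max 0 (((N S)%:R - K) / n%:R).

Lemma induced_col_ge0 S : 0 <= induced_col S.
Proof. by rewrite /induced_col le_max lexx. Qed.

(** The splittings with union [A] are those of the [s A] new vertices joined to [A]. Withholding [K]
    from each splitting costs at most the surplus built into [s A]. *)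
Lemma induced_col_gt A : g A < \sum_(S : disjoint_tuple r (wvert g)
  | (\bigcup_(i < r) val S i)%SET == A) induced_col S.
Proof.
have n0 : 0 < n%:R :> R by rewrite ltr0n.
set P := (X in \sum_(S | X S) _).
apply: (@lt_le_trans _ _ (\sum_(S | P S) ((N S)%:R - K) / n%:R)); last first.
  by apply: ler_sum => S _; rewrite /induced_col le_max lexx orbT.
rewrite -mulr_suml ltr_pdivlMr // sumrB -natr_sum sum_card_fibre.
rewrite (_ : #|_| = s A); last first.
  have -> : s A = (\sum_(C | pred1 A C) #|'I_(s C)|)%N.
    by rewrite big_pred1_eq card_ord.
  rewrite -card_sum_label; apply: eq_card => y.
  by rewrite !inE /P split_tuple_cup.
have : \sum_(S | P S) K <= #|{: disjoint_tuple r (wvert g)}|%:R * K.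
  rewrite sumr_const -[leLHS]mulr_natl ler_wpM2r // ler_nat.
  exact: max_card.
have := s_gt A; lra.
Qed.

Definition induced_colouring : wcolouring r g :=
  WColouring induced_col_ge0 induced_col_gt.

(** A single splitting [S0] of positive weight supplies the whole reserve [K]; for every other
    splitting the weight times [n] is at most the number of vertices. *)
Lemma induced_col_slack i (B : {set wvert g}) :
  0 < csub induced_colouring i B ->
  csub induced_colouring i B * n%:R + K
    <= #|[pred y | val (vertex_tuple y) i == B]|%:R.
Proof.
have n0 : 0 < n%:R :> R by rewrite ltr0n.
rewrite /= /csub_val /= => /psumr_gt0_ex[S0 S0B c0].
rewrite -(sum_card_fibre vertex_tuple (fun S => val S i == B)) natr_sum.
rewrite (bigD1 S0) //= [in leRHS](bigD1 S0) //= mulrDl.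
have cS0 : induced_col S0 * n%:R = (N S0)%:R - K.
  move: c0; rewrite /induced_col lt_max ltxx /= => c0.
  by rewrite max_r ?ltW // divfK ?gt_eqF.
rewrite addrAC; apply: lerD.
  by rewrite -lerBrDr le_eqVlt; apply/orP; left; apply/eqP; exact: cS0.
rewrite mulr_suml; apply: ler_sum => S _; rewrite /induced_col.
by rewrite -ler_pdivlMr // ge_max divr_ge0 //= ler_pM2r ?invr_gt0 // gerBl.
Qed.

Lemma blowup_edge i x y : x \in val (vertex_tuple y) i ->
  @gedge (cclass chi i) (inl x) (inr y) /\
  @gedge (cclass chi i) (inr y) (inl x).
Proof.
rewrite split_tupleE => /andP[xy xyi].
by split; rewrite /= /cclass_edge /= xy //= finset.setUC.
Qed.

(** The plan [w], scaled by [n], is rounded up to an integral plan [m], which [transport] turns into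
    an injection of the second class of [B]. Rounding raises a column by at most [1 + e] per subset
    of [wvert f], which the reserve [K] covers. *)
Lemma weight_copy i (f : weight R) (B : bigraph (wvert f)) (e : R) :
  w_no_isolated f -> 0 <= e -> 2 ^+ #|wvert f| * (1 + e) <= K ->
  (forall A, (bpart B A = finset.set0 <-> f A = 0) /\
        `| #|bpart B A|%:R - f A * n%:R | <= e) ->
  weight_in_weight f (csub induced_colouring i) ->
  gcopy (bg_graph B) (cclass chi i).
Proof.
move=> f_iso e_ge0 eK HB.
move=> /(wembed_unpadded f_iso)[h [w [h_inj w_ge0 w_sub fw wg]]].
have n0 : 0 < n%:R :> R by rewrite ltr0n.
(* The summand [e] is added because a class of [B] may exceed [f A * n] by [e]. Entries with
   [w A C = 0] stay 0, so that [0 < m A C] still implies [h @: A \subset C]. *)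
pose m A C : nat :=
  if 0 < w A C then (Num.truncn (w A C * n%:R + e)).+1 else 0%N.
have we_ge0 A C : 0 <= w A C * n%:R + e by rewrite addr_ge0 // mulr_ge0.
have m_gt A C : 0 < w A C -> w A C * n%:R + e <= (m A C)%:R.
  by move=> wAC; rewrite /m wAC; have /andP[_ /ltW] := truncn_itv (we_ge0 A C).
have m_ge A C : w A C * n%:R <= (m A C)%:R.
  have [/m_gt|] := ltrP 0 (w A C); first lra.
  by move=> wAC; rewrite (le_trans _ (ler0n _ _)) // mulr_le0_ge0.
have m_le A C : (m A C)%:R <= w A C * n%:R + (1 + e).
  rewrite /m; case: ifP => _; last by have := we_ge0 A C; lra.
  have /andP[+ _] := truncn_itv (we_ge0 A C).
  by rewrite -natr1; lra.
have [A|C|phi [phi_inj phi_m]] := @transport (bvert2 B) (bvert2 (blowup s)) _ _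
    (fun v => [set x | badj x v]) (fun y => val (vertex_tuple y) i) m.
- have [BA0 BAf] := HB A.
  have -> : #|[pred v : bvert2 B | [set x | badj x v] == A]| = #|bpart B A|.
    by apply: eq_card => v; rewrite !inE.
  (* If [f A = 0], the row may have no positive entry to carry the summand [e]; here the class of
     [B] is exactly empty. *)
  have [fA0|fA0] := eqVneq (f A) 0; first by rewrite (BA0.2 fA0) cards0.
  have [C _ wAC] : exists2 C, true & 0 < w A C.
    apply: psumr_gt0_ex; apply: lt_le_trans (fw A).
    by rewrite lt_def fA0 wval_ge0.
  rewrite -(ler_nat R) natr_sum (bigD1 C) //=.
  have := fw A; rewrite (bigD1 C) //= => fwA.
  have : f A * n%:R <= (w A C + \sum_(j | j != C) w A j) * n%:R.
    by rewrite ler_wpM2r // ltW.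
  have : (\sum_(j | j != C) w A j) * n%:R <= \sum_(j | j != C) (m A j)%:R.
    by rewrite mulr_suml; apply: ler_sum => D _; exact: m_ge.
  move: BAf; rewrite ler_norml => /andP[_]; have := m_gt _ _ wAC; lra.
- have [cC|cC] := ltrP 0 (csub induced_colouring i C); last first.
    rewrite big1 // => A _; rewrite /m ifF //; apply/negbTE; rewrite -leNgt.
    apply: le_trans cC; apply: le_trans (wg C).
    exact: (@ler_term_sum _ _ predT (fun A => w A C)).
  rewrite -(ler_nat R); apply: le_trans (induced_col_slack _ _ cC).
  rewrite natr_sum.
  apply: (@le_trans _ _ (\sum_A (w A C * n%:R + (1 + e)))).
    by apply: ler_sum => A _; exact: m_le.
  rewrite big_split /= -mulr_suml lerD ?ler_wpM2r ?(ltW n0) //.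
  by rewrite sum_const_sets natrX.
- have phi_edge x v : badj x v -> h x \in val (vertex_tuple (phi v)) i.
    move=> xv; have := phi_m v; rewrite {1}/m.
    case: ifP => // /w_sub/fintype.subsetP + _; apply.
    by apply: imset_f; rewrite inE.
  exists (fun u => match u with inl x => inl (h x) | inr v => inr (phi v) end).
  split=> [[x|v] [x'|v'] //= []|[x|v] [x'|v'] //= /phi_edge].
  + by move=> /h_inj ->.
  + by move=> /phi_inj ->.
  + by case/blowup_edge.
  + by case/blowup_edge.
Qed.

(** Each vertex [y] outside [V1] gets a set [beta y] of positive colour weight containing the image
    of its neighbourhood. Positive weight means at least [K] suitable new vertices, enough to choose
    distinct ones for all of [F]. *)
Lemma graph_copy i (F : sgraph) : #|F|%:R <= K ->
  graph_in_weight F (csub induced_colouring i) -> gcopy F (cclass chi i).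
Proof.
move=> FK [V1 [bipV1 [h [h_inj hdom]]]].
have n0 : 0 < n%:R :> R by rewrite ltr0n.
have nbr_sub (y : F) : y \notin V1 -> gnbr y \subset V1.
  move=> yV1; apply/fintype.subsetP => x; rewrite inE => /bipV1.
  by rewrite (negbTE yV1); case: (x \in V1).
have domP (y : {y : F | y \notin V1}) : exists B : {set wvert g},
    h @: gnbr (val y) \subset B /\ 0 < csub induced_colouring i B.
  by apply: hdom (nbr_sub _ (valP y)) _; exists (val y); rewrite ?(valP y).
pose beta y := sval (cid (domP y)).
have betaP y : h @: gnbr (val y) \subset beta y /\
    0 < csub induced_colouring i (beta y) by rewrite /beta; case: cid.
have [B|phi [phi_inj phiE]] := @label_injection _ (bvert2 (blowup s)) _ beta
    (fun y => val (vertex_tuple y) i).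
  have [y /eqP yB|B0] := pickP [pred y | beta y == B]; last first.
    by rewrite (eq_card0 B0).
  have := (betaP y).2; rewrite yB => cB.
  rewrite -(ler_nat R); apply: le_trans (induced_col_slack _ _ cB).
  have : csub induced_colouring i B * n%:R >= 0 by rewrite mulr_ge0 ?wval_ge0.
  suff : #|[pred y | beta y == B]|%:R <= #|F|%:R :> R by lra.
  rewrite ler_nat; apply: leq_trans (max_card _) _.
  by rewrite card_sig max_card.
pose k (u : F) : cclass chi i :=
  if insub u is Some y then inr (phi y) else inl (h u).
have k1 u : u \in V1 -> k u = inl (h u) by move=> uV; rewrite /k insubN ?negbK.
have k2 u (uV : u \notin V1) : k u = inr (phi (Sub u uV)) by rewrite /k insubT.
have edge x y (yV : y \notin V1) : gedge x y ->
    h x \in val (vertex_tuple (phi (Sub y yV))) i.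
  move=> xy; rewrite phiE; apply: (fintype.subsetP (betaP (Sub y yV)).1).
  by apply: imset_f; rewrite inE gedge_sym.
exists k; split=> [x y|x y xy].
  have [xV|xV] := boolP (x \in V1); have [yV|yV] := boolP (y \in V1).
  - by rewrite !k1 // => -[] /h_inj; apply.
  - by rewrite k1 // k2.
  - by rewrite k2 k1.
  - by rewrite !k2 => -[] /phi_inj/(congr1 val).
have := bipV1 _ _ xy.
have [xV|xV] := boolP (x \in V1); have [yV|yV] := boolP (y \in V1) => // _.
  by rewrite k1 // k2; have /blowup_edge[] := edge x y yV xy.
rewrite k2 k1 //; have yx : gedge y x by rewrite gedge_sym.
by have /blowup_edge[] := edge y x xV yx.
Qed.
End WeightToGraph.

(** Besides [g A * n], each of the at most [2 ^ l] sets, of size at most [l], gets at most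
    [D * K' + 1] further vertices; this gives the constant. *)
Lemma weight_to_graph {R : realType} {r l K : nat}
    {T : 'I_r -> weight R + sgraph} {g : weight R} {n : nat} {e : R}
    {H : 'I_r -> sgraph} :
  (forall i, target_bound K (T i)) -> (forall i, target_nondeg (T i)) ->
  (#|wvert g| <= l)%N -> warrows g T -> (0 < n)%N -> 0 <= e ->
  (forall i, realizes n e (T i) (H i)) ->
  exists2 G, garrows G H &
    (gsize G)%:R <=
      wsize g * n%:R + (2 ^ l * l * ((2 ^ l) ^ r * K + 1))%:R * (1 + e).
Proof.
move=> TK Tnd gl gT n_gt0 e_ge0 TH.
set D := #|{: disjoint_tuple r (wvert g)}|%:R : R.
(* This reserve serves weight targets, which need [2 ^+ #|wvert f| * (1 + e)], as well as graph
   targets, which need [#|F|]. *)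
pose K' : R := K%:R * (1 + e).
have K'_ge0 : 0 <= K' by rewrite mulr_ge0 ?addr_ge0.
pose s A := (Num.truncn (g A * n%:R + D * K')).+1.
have b_ge0 A : 0 <= g A * n%:R + D * K'.
  by apply: addr_ge0; apply: mulr_ge0 => //; exact: wval_ge0.
have s_gt A : g A * n%:R + D * K' < (s A)%:R.
  by have /andP[] := truncn_itv (b_ge0 A).
exists (bg_graph (blowup s)).
  move=> chi; have [i] := gT (induced_colouring n_gt0 K'_ge0 s s_gt chi).
  have := TK i; have := Tnd i; have := TH i.
  case Ti: (T i) => [f|F] /=; last first.
    move=> HF _ FK cF; exists i; rewrite HF; apply: graph_copy cF.
    rewrite /K' (le_trans (_ : _ <= K%:R)) ?ler_nat //.
    by rewrite ler_peMr ?lerDl.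
  move=> [B HB Be] f_iso fK cf; exists i; rewrite HB.
  apply: weight_copy Be cf => //.
  by rewrite /K' ler_wpM2r ?addr_ge0 // -natrX ler_nat.
apply: le_trans (_ : (\sum_A s A * #|A|)%:R <= _).
  by rewrite ler_nat; exact: gsize_blowup.
have sA A : (s A * #|A|)%:R <= g A * #|A|%:R * n%:R
    + (l * ((2 ^ l) ^ r * K + 1))%:R * (1 + e).
  have /andP[+ _] := truncn_itv (b_ge0 A) => sA.
  have Al : #|A|%:R <= l%:R :> R.
    by rewrite ler_nat; apply: leq_trans (max_card _) gl.
  have DK : D * K' + 1 <= ((2 ^ l) ^ r * K + 1)%:R * (1 + e).
    rewrite natrD natrM mulrDl mul1r lerD ?lerDl //.
    rewrite /K' mulrA ler_wpM2r ?addr_ge0 //.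
    by rewrite ler_wpM2r // ler_nat; exact: card_disjoint_tuple.
  have DK0 : 0 <= D * K' + 1 by apply: addr_ge0 => //; apply: mulr_ge0.
  have sl : (s A)%:R <= g A * n%:R + (D * K' + 1) by rewrite /s -natr1; lra.
  rewrite natrM; apply: le_trans (ler_wpM2r (ler0n _ _) sl) _.
  rewrite mulrDl mulrAC lerD2l natrM -[leRHS]mulrA [leLHS]mulrC.
  by apply: ler_pM.
rewrite natr_sum; apply: le_trans (ler_sum _ (fun A _ => sA A)) _.
rewrite big_split /= -mulr_suml lerD2l sum_const_sets mulrA -natrM.
by rewrite ler_wpM2r ?addr_ge0 // ler_nat -mulnA leq_mul2r leq_pexp2l ?orbT.
Qed.

(** * From graphs to weights *)

Section GraphToWeight.
Context {R : realType} {r : nat} {G : sgraph}.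
Context (L : {set G}) (x0 : {x | x \in L}).
Context {n : nat} (n_gt0 : (0 < n)%N).
Context {K P : R} (K_ge0 : 0 <= K) (P_ge0 : 0 <= P).
Let V : finType := {x : G | x \in L}.
Let U : finType := {y : G | y \notin L}.

Definition trace (y : U) : {set V} := [set x : V | gedge (val x) (val y)].

(* The extra [P] pays for all roundings when a colouring of the weight is
   transferred to [G]. *)
Definition trace_weight_val (A : {set V}) : R :=
  (#|[pred y | trace y == A]|%:R + P) / n%:R.

Lemma trace_weight_ge0 A : 0 <= trace_weight_val A.
Proof. by rewrite divr_ge0 // addr_ge0. Qed.

Lemma trace_weight_gt0 : (0 < #|{: V}|)%N.
Proof. by apply/card_gt0P; exists x0. Qed.

Definition trace_weight : weight R := Weight trace_weight_gt0 trace_weight_ge0.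

(** The counting part of the weight sees each edge between [L] and its complement once; [P] is paid
    at most [#|L|] times for each subset of [L]. *)
Lemma wsize_trace_weight :
  wsize trace_weight * n%:R <= (gsize G)%:R + (2 ^ #|L| * #|L|)%:R * P.
Proof.
have n0 : 0 < n%:R :> R by rewrite ltr0n.
have cardV : #|{: V}| = #|L| by rewrite card_sig; apply: eq_card.
have traceG : (\sum_A #|[pred y | trace y == A]| * #|A| <= gsize G)%N.
  have -> : (\sum_A #|[pred y | trace y == A]| * #|A| = \sum_y #|trace y|)%N.
    rewrite [RHS](partition_big trace predT) //=; apply: eq_bigr => A _.
    rewrite -sum_nat_const; apply: eq_big => y; first by rewrite inE.
    by rewrite inE => /eqP ->.
  pose Q := [set p : V * U | gedge (val p.1) (val p.2)].
  have -> : (\sum_y #|trace y| = #|Q|)%N.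
    rewrite -[RHS]sum1_card.
    rewrite (eq_bigl (fun p : V * U => predT p.1 && gedge (val p.1) (val p.2)));
      last first.
      by move=> p; rewrite inE.
    rewrite -(pair_big_dep predT
      (fun (x : V) (y : U) => gedge (val x) (val y)) (fun _ _ => 1%N)) /=.
    rewrite (exchange_big_dep predT) //=; apply: eq_bigr => y _.
    by rewrite -sum1_card; apply: eq_bigl => x; rewrite inE.
  have pair_inj : {in Q &, injective (fun p : V * U => [set val p.1; val p.2])}.
    move=> [x y] [x' y'] _ _ /= eqp.
    have : val x \in [set val x'; val y'] by rewrite -eqp set21.
    have : val y \in [set val x'; val y'] by rewrite -eqp set22.
    rewrite !inE => /orP[] /eqP ey /orP[] /eqP ex.
    - by have := valP y; rewrite ey (valP x').
    - by have := valP y; rewrite ey (valP x').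
    - by congr (_, _); exact: val_inj.
    - by have := valP y'; rewrite -ex (valP x).
  rewrite -(card_in_imset pair_inj); apply: subset_leq_card.
  apply/fintype.subsetP => _ /imsetP[p + ->]; rewrite inE => xy.
  by apply/imsetP; exists (val p.1, val p.2); rewrite ?inE.
rewrite /wsize mulr_suml.
apply: (@le_trans _ _ (\sum_(A : {set V})
    ((#|[pred y | trace y == A]| * #|A|)%:R + #|L|%:R * P))).
  apply: ler_sum => A _; rewrite /= /trace_weight_val mulrAC divfK ?gt_eqF //.
  rewrite natrM mulrDl lerD2l mulrC ler_wpM2r // ler_nat -cardV.
  exact: max_card.
rewrite big_split /= -natr_sum lerD ?ler_nat //.
by rewrite sum_const_sets cardV mulrA -natrM.
Qed.

Variable c : wcolouring r trace_weight.
Hypothesis P_large : #|{: disjoint_tuple r V}|%:R * (K + 1) <= P.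

(** How many vertices outside [L] may receive the splitting [S]. The reserve [K] is withheld, so a
    splitting in use leaves at least [K] to spare. *)
Definition quota (S : disjoint_tuple r V) : nat :=
  Num.truncn (Num.max 0 (c S * n%:R - K)).

Lemma quota_le S : (quota S)%:R <= c S * n%:R.
Proof.
have m_ge0 : 0 <= Num.max 0 (c S * n%:R - K) by rewrite le_max lexx.
have /andP[/le_trans + _] := truncn_itv m_ge0; apply.
by rewrite ge_max mulr_ge0 ?wcol_ge0 //= gerBl.
Qed.

Lemma quota_gt0 S : (0 < quota S)%N -> (quota S)%:R <= c S * n%:R - K.
Proof.
have m_ge0 : 0 <= Num.max 0 (c S * n%:R - K) by rewrite le_max lexx.
have /andP[+ _] := truncn_itv m_ge0; rewrite -/(quota S).
by rewrite -(ltr_nat R) maxElt; case: ifP => //; lra.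
Qed.

(** For each [A] the quotas of the splittings of [A] suffice for all vertices with trace [A]:
    withholding [K] and rounding down lose at most [K + 1] per splitting, which [P] has paid in
    advance. *)
Lemma trace_split : exists sigma : U -> disjoint_tuple r V,
  (forall y, (\bigcup_(i < r) val (sigma y) i)%SET = trace y) /\
  forall S, (#|[pred y | sigma y == S]| <= quota S)%N.
Proof.
have n0 : 0 < n%:R :> R by rewrite ltr0n.
pose cup (S : disjoint_tuple r V) : {set V} := (\bigcup_(i < r) val S i)%SET.
have [A|phi [phi_inj phiE]] := @label_injection U
    {S : disjoint_tuple r V & 'I_(quota S)} _ trace (fun s => cup (tag s)).
  rewrite (card_sum_label _ (fun S => cup S == A)) -(ler_nat R) natr_sum.
  under eq_bigr do rewrite card_ord.
  have := wcol_gt c A; rewrite /= /trace_weight_val ltr_pdivrMr // mulr_suml.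
  set s1 := \sum_(S | _) _ => cA.
  have : s1 <= \sum_(S | cup S == A) ((quota S)%:R + (K + 1)).
    apply: ler_sum => S _.
    have m_ge0 : 0 <= Num.max 0 (c S * n%:R - K) by rewrite le_max lexx.
    have /andP[_] := truncn_itv m_ge0.
    rewrite -/(quota S) gt_max -natr1 => /andP[_]; lra.
  rewrite big_split /= sumr_const.
  have : (K + 1) *+ #|[pred S | cup S == A]| <= P.
    apply: le_trans P_large; rewrite -[leLHS]mulr_natl ler_wpM2r ?addr_ge0 //.
    by rewrite ler_nat max_card.
  lra.
exists (fun y => tag (phi y)); split=> [y|S]; first exact: phiE.
apply: leq_trans (_ : #|[pred s : {S : disjoint_tuple r V & 'I_(quota S)}
                        | pred1 S (tag s)]| <= _)%N; last first.
  by rewrite card_sum_label big_pred1_eq card_ord.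
rewrite -[leqLHS](card_imset _ phi_inj); apply: subset_leq_card.
by apply/fintype.subsetP => _ /imsetP[y + ->]; rewrite !inE.
Qed.

Variable sigma : U -> disjoint_tuple r V.
Hypothesis sigma_cup :
  forall y, (\bigcup_(i < r) val (sigma y) i)%SET = trace y.
Hypothesis sigma_quota : forall S, (#|[pred y | sigma y == S]| <= quota S)%N.
Variable i1 : 'I_r.

Lemma sigma_slack i (B : {set V}) :
  (0 < #|[pred y | val (sigma y) i == B]|)%N ->
  #|[pred y | val (sigma y) i == B]|%:R + K <= csub c i B * n%:R.
Proof.
move=> /card_gt0P[y0 /eqP y0B].
rewrite -(sum_card_fibre sigma (fun S => val S i == B)) natr_sum.
rewrite /= /csub_val mulr_suml (bigD1 (sigma y0)) ?y0B //=.
rewrite [leRHS](bigD1 (sigma y0)) ?y0B //=.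
have S0 : (0 < #|[pred y | sigma y == sigma y0]|)%N.
  by apply/card_gt0P; exists y0; rewrite inE.
have := quota_gt0 _ (leq_trans S0 (sigma_quota _)).
have := sigma_quota (sigma y0); rewrite -(ler_nat R).
suff : \sum_(S : disjoint_tuple r V | (val S i == B) && (S != sigma y0))
    #|[pred y | sigma y == S]|%:R <=
  \sum_(S : disjoint_tuple r V | (val S i == B) && (S != sigma y0)) c S * n%:R
  by lra.
apply: ler_sum => S _; apply: le_trans (quota_le S).
by rewrite ler_nat sigma_quota.
Qed.

(* Edges not joining [L] to its complement get the colour [i1]. *)
Definition crossing_col (E : {set G}) (i : 'I_r) : bool :=
  [exists x : V, exists y : U,
    (E == [set val x; val y]) && (x \in val (sigma y) i)].

Definition trace_col (E : {set G}) : 'I_r :=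
  odflt i1 [pick i | crossing_col E i].

(** An edge between [L] and its complement determines its ends [x] and [y]. Some colour crosses it,
    since the parts of [sigma y] cover [trace y], so the default [i1] does not occur here. *)
Lemma trace_col_crossing i x y :
  gedge (val x) (val y) -> trace_col [set val x; val y] = i ->
  x \in val (sigma y) i.
Proof.
move=> xy <-; rewrite /trace_col; case: pickP => [j|none] /=.
  move=> /existsP[x' /existsP[y' /andP[/eqP eqE]]].
  have : val x \in [set val x'; val y'] by rewrite -eqE set21.
  have : val y \in [set val x'; val y'] by rewrite -eqE set22.
  rewrite !inE => /orP[] /eqP ey /orP[] /eqP ex.
  - by have := valP y; rewrite ey (valP x').
  - by have := valP y; rewrite ey (valP x').
  - by rewrite (val_inj ex) (val_inj ey).
  - by have := valP y'; rewrite -ex (valP x).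
have : x \in trace y by rewrite inE.
rewrite -sigma_cup => /bigcupP[j _ xj].
have := none j; rewrite /crossing_col => /existsP[]; exists x.
by apply/existsP; exists y; rewrite eqxx.
Qed.

Lemma trace_col_other i u v : i != i1 -> trace_col [set u; v] = i ->
  (u \in L) != (v \in L).
Proof.
move=> ii1; rewrite /trace_col; case: pickP => [j|_] /=; last first.
  by move=> ei; rewrite ei eqxx in ii1.
move=> /existsP[x /existsP[y /andP[/eqP eqE _]]] _.
have := valP x; have := valP y.
have : val x \in [set u; v] by rewrite eqE set21.
have : val y \in [set u; v] by rewrite eqE set22.
rewrite !inE => /orP[] /eqP -> /orP[] /eqP -> /negbTE -> //= ->; by [].
Qed.

(** In a colour other than [i1] all edges cross between [L] and its complement, so the preimage of
    [L] is one class of a bipartition of [F]. A vertex mapped to [y'] outside [L] has the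
    neighbourhood required by [val (sigma y') i], whose colour weight is positive by the slack. *)
Lemma graph_trace i (F : sgraph) : i != i1 ->
  gcopy F (cclass trace_col i) -> graph_in_weight F (csub c i).
Proof.
move=> ii1 [h [h_inj h_edge]].
have n0 : 0 < n%:R :> R by rewrite ltr0n.
have hE (x y : F) : gedge x y ->
    @gedge G (h x) (h y) /\ trace_col [set h x; h y] = i.
  by move=> /h_edge /andP[? /eqP].
pose h' x : V := insubd x0 (h x).
have h'E x : h x \in L -> val (h' x) = h x by move=> hx; rewrite val_insubd hx.
exists [set x | h x \in L]; split=> [x y /hE[_]|].
  by rewrite !inE; exact: trace_col_other.
exists h'; split=> [x y|A A_sub [y yV A_y]].
  by rewrite !inE => hx hy /(congr1 val); rewrite !h'E // => /h_inj.
have hy : h y \notin L by move: yV; rewrite inE.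
pose y' : U := Sub (h y) hy.
exists (val (sigma y') i); split.
  apply/fintype.subsetP => _ /imsetP[x xA ->].
  have hx : h x \in L by have := fintype.subsetP A_sub x xA; rewrite inE.
  have : gedge x y by have := fintype.subsetP A_y x xA; rewrite inE gedge_sym.
  by move=> /hE[hxy hi]; apply: trace_col_crossing; rewrite h'E.
have : (0 < #|[pred y | val (sigma y) i == val (sigma y') i]|)%N.
  by apply/card_gt0P; exists y'; rewrite inE.
move=> N0; rewrite -(pmulr_lgt0 _ n0).
by apply: lt_le_trans (sigma_slack _ _ N0); rewrite ltr_wpDr // ltr0n.
Qed.

(** The degree condition forces the vertices of [f] into [L]. At most [#|L|] vertices of the second
    class land in [L]; the others use edges crossing between [L] and its complement, whose colours
    come from [c]. This holds for [i = i1] as well. *)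
Lemma weight_trace i (f : weight R) (B : bigraph (wvert f)) (e d : R) :
  0 <= e -> 2 ^+ #|wvert f| * (#|L|%:R + e) <= K ->
  (forall z : G, z \notin L -> #|gnbr z|%:R < d) ->
  (forall x, d <= #|[set v : bvert2 B | badj x v]|%:R) ->
  (forall A, f A * n%:R - e <= #|bpart B A|%:R) ->
  (forall A, f A != 0 -> #|L|%:R + e < f A * n%:R) ->
  gcopy (bg_graph B) (cclass trace_col i) -> weight_in_weight f (csub c i).
Proof.
move=> e_ge0 eK small_deg large_deg Bf f_large [h [h_inj h_edge]].
have n0 : 0 < n%:R :> R by rewrite ltr0n.
have hE (x y : bg_graph B) : gedge x y ->
    @gedge G (h x) (h y) /\ trace_col [set h x; h y] = i.
  by move=> /h_edge /andP[? /eqP].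
have hL x : h (inl x) \in L.
  apply: contraT => /small_deg; rewrite ltNge => /negP[].
  apply: le_trans (large_deg x) _; rewrite ler_nat.
  have g_inj : injective (fun v : bvert2 B => h (inr v)).
    by move=> v v' /h_inj[].
  rewrite -(card_imset _ g_inj); apply: subset_leq_card.
  apply/fintype.subsetP => _ /imsetP[v + ->]; rewrite !inE => xv.
  by have [] := hE (inl x) (inr v) xv.
pose h' x : V := Sub (h (inl x)) (hL x).
have h'_inj : injective h' by move=> x y /(congr1 val)/h_inj[].
pose nbr (v : bvert2 B) := [set x | badj x v].
(* The integral plan read off from the copy: vertices of [B] with neighbourhood [A] placed outside
   [L] at a vertex whose part of colour [i] is [C]. *)
pose m (A : {set wvert f}) (C : {set V}) :=
  #|[pred v : bvert2 B | (nbr v == A) &&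
  [exists y : U, (val y == h (inr v)) && (val (sigma y) i == C)]]|.
have m_sub (A : {set wvert f}) C : (0 < m A C)%N -> h' @: A \subset C.
  move=> /card_gt0P[v]; rewrite inE => /andP[/eqP <- /existsP[y]].
  move=> /andP[/eqP yv /eqP <-]; apply/fintype.subsetP => _ /imsetP[x + ->].
  rewrite inE => xv; have [] := hE (inl x) (inr v) xv.
  by rewrite -yv => xy coli; apply: trace_col_crossing.
have m_row A : (#|bpart B A| <= #|L| + \sum_C m A C)%N.
  have sub : bpart B A \subset [set v | h (inr v) \in L] :|:
      [set v | (nbr v == A) && (h (inr v) \notin L)].
    apply/fintype.subsetP => v; rewrite !inE => ->.
    by case: (h (inr v) \in L).
  apply: leq_trans (subset_leq_card sub) _.
  apply: leq_trans (leq_card_setU _ _) _; apply: leq_add.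
    have g_inj : injective (fun v : bvert2 B => h (inr v)).
      by move=> v v' /h_inj[].
    rewrite -(card_imset _ g_inj); apply: subset_leq_card.
    by apply/fintype.subsetP => _ /imsetP[v + ->]; rewrite inE.
  rewrite -sum1_card /m.
  under [leqRHS]eq_bigr do rewrite -sum1_card.
  rewrite (exchange_big_dep (fun v => nbr v == A)) /=; last first.
    by move=> C v _; rewrite inE => /andP[].
  rewrite big_mkcond [leqRHS]big_mkcond /=; apply: leq_sum => v _.
  rewrite inE; case: (eqVneq (nbr v) A) => //= vA.
  case: (boolP (h (inr v) \in L)) => //= hv.
  rewrite (bigD1 (val (sigma (Sub (h (inr v)) hv)) i)) //=.
  rewrite inE vA eqxx /=; apply/existsP; exists (Sub (h (inr v)) hv).
  by rewrite !eqxx.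
have m_col C : (\sum_A m A C <= #|[pred y | val (sigma y) i == C]|)%N.
  pose Q (v : bvert2 B) :=
    [exists y : U, (val y == h (inr v)) && (val (sigma y) i == C)].
  have -> : (\sum_A m A C = #|[pred v | Q v]|)%N.
    rewrite -[RHS]sum1_card (partition_big nbr predT) //=.
    apply: eq_bigr => A _; rewrite /m -sum1_card.
    by apply: eq_bigl => v; rewrite !inE andbC.
  have g_inj : injective (fun v : bvert2 B => h (inr v)).
    by move=> v v' /h_inj[].
  rewrite -(card_imset _ g_inj).
  apply: leq_trans (leq_imset_card (val : U -> G) _); apply: subset_leq_card.
  apply/fintype.subsetP => _ /imsetP[v + ->]; rewrite inE.
  move=> /existsP[y /andP[/eqP <- yC]].
  by apply: imset_f; rewrite inE.
(* The correction makes up for the vertices of [B] mapped into [L] and for the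
     error [e]; it may only be added where the colour weight is positive. *)
  pose w A C : R := ((m A C)%:R + (0 < m A C)%N%:R * (#|L|%:R + e)) / n%:R.
apply: (@wembed_padded _ f (csub c i) h' w h'_inj) => [A C|A C|A|C].
- by rewrite divr_ge0 ?addr_ge0 ?mulr_ge0 ?addr_ge0.
- rewrite /w; case: (posnP (m A C)) => [->|/m_sub //].
  by rewrite mul0r addr0 mul0r ltxx.
- have [fA0|fA0] := eqVneq (f A) 0.
    rewrite fA0 sumr_ge0 // => C _.
    by rewrite divr_ge0 ?addr_ge0 ?mulr_ge0 ?addr_ge0.
  have := f_large A fA0; have := Bf A; have := m_row A.
  rewrite -(ler_nat R) natrD natr_sum => mA BfA fAL.
  rewrite -mulr_suml ler_pdivlMr //.
  have [C _] : exists2 C, true & 0 < (m A C)%:R :> R.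
    by apply: psumr_gt0_ex; lra.
  rewrite ltr0n => mAC; rewrite big_split /=.
  suff : #|L|%:R + e <= \sum_C (0 < m A C)%N%:R * (#|L|%:R + e) by lra.
  rewrite (bigD1 C) //= mAC mul1r lerDl sumr_ge0 // => D _.
  by rewrite mulr_ge0 ?addr_ge0.
- rewrite -mulr_suml ler_pdivrMr //.
  have [N0|N0] := posnP #|[pred y | val (sigma y) i == C]|.
    have m0 A : m A C = 0%N.
      apply/eqP; rewrite -leqn0 -N0; apply: leq_trans (m_col C).
      by rewrite (bigD1 A) //= leq_addr.
    rewrite big1; first by rewrite mulr_ge0 ?wval_ge0.
    by move=> A _; rewrite m0 mul0r addr0.
  apply: le_trans (sigma_slack _ _ N0); rewrite big_split /= -natr_sum.
  rewrite lerD ?ler_nat //; apply: le_trans eK.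
  apply: (@le_trans _ _ (\sum_(A : {set wvert f}) (#|L|%:R + e))).
    apply: ler_sum => A _; rewrite ler_piMl ?addr_ge0 //.
    by case: (0 < _)%N.
  by rewrite sum_const_sets natrX.
Qed.
End GraphToWeight.

(** The factor 2 leaves degree [d * n] in a dilatation after the errors of all classes are
    subtracted. *)
Definition target_sep {R : realType} (d : R) (T : weight R + sgraph) : Prop :=
  if T is inl f then
    (forall x : wvert f, 2 * d <= wdeg x) /\
    (forall A : {set wvert f}, f A != 0 -> d <= f A)
  else True.

Lemma card_badj_ge {R : realType} {f : weight R} {n : nat} {e : R}
    {B : bigraph (wvert f)} (x : wvert f) :
  0 <= e -> (forall A, f A * n%:R - e <= #|bpart B A|%:R) ->
  wdeg x * n%:R - 2 ^+ #|wvert f| * e <= #|[set v : bvert2 B | badj x v]|%:R.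
Proof.
move=> e_ge0 HB.
have -> : #|[set v : bvert2 B | badj x v]|
    = (\sum_(A : {set wvert f} | x \in A) #|bpart B A|)%N.
  rewrite (eq_bigr (fun A => #|[pred v : bvert2 B | [set y | badj y v] == A]|)).
    rewrite (sum_card_fibre (fun v : bvert2 B => [set y | badj y v])
      (fun A => x \in A)).
    by apply: eq_card => v; rewrite !inE.
  by move=> A _; apply: eq_card => v; rewrite !inE.
rewrite natr_sum.
apply: le_trans (ler_sum _ (fun A _ => HB A)).
rewrite sumrB /wdeg -mulr_suml lerD2l lerN2 -natrX -sum_const_sets.
by rewrite [leRHS](bigID (fun A : {set wvert f} => x \in A)) /= lerDl sumr_ge0.
Qed.

Lemma weight0_ge0 {R : realType} (A : {set unit}) : 0 <= (0 : R).
Proof. by []. Qed.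

Lemma card_unit_gt0 : (0 < #|{: unit}|)%N.
Proof. by rewrite card_unit. Qed.

Definition weight0 {R : realType} : weight R :=
  Weight card_unit_gt0 (@weight0_ge0 R).

(** With at most [C * n] edges, at most [2 * C / d] vertices have degree [d * n] or more. These make
    up [L], and [trace_weight] is the required weight. *)
Lemma graph_to_weight {R : realType} {r l K : nat} {d C : R}
    {T : 'I_r -> weight R + sgraph} {i1 : 'I_r} {f1 : weight R}
    {n : nat} {e : R} {H : 'I_r -> sgraph} {G : sgraph} :
  (forall i, target_bound K (T i)) -> (forall i, target_sep d (T i)) ->
  T i1 = inl f1 -> 0 < d -> 2 * C / d < l%:R ->
  (0 < n)%N -> 0 <= e -> K%:R * e <= d * n%:R -> l%:R + e < d * n%:R ->
  (forall i, realizes n e (T i) (H i)) -> garrows G H ->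
  (gsize G)%:R <= C * n%:R ->
  exists g : weight R, [/\ (#|wvert g| <= l)%N, warrows g T &
    wsize g * n%:R <= (gsize G)%:R +
      (2 ^ l * l * ((2 ^ l) ^ r * (K * l + K + 1)))%:R * (1 + e)].
Proof.
move=> TK Td Ti1 d_gt0 lC n_gt0 e_ge0 Ke le TH GH GC.
have n0 : 0 < n%:R :> R by rewrite ltr0n.
have C_ge0 : 0 <= C by rewrite -(pmulr_lge0 _ n0); apply: le_trans GC.
have l_gt0 : (0 < l)%N.
  rewrite -(ltr_nat R); apply: le_lt_trans lC.
  by rewrite divr_ge0 ?mulr_ge0 // ltW.
(* If [G] has no vertices, a target found in it has none either. It is then an empty graph, which
   every weight contains, so [weight0] arrows. *)
have [x0 _|G0] := pickP (@predT G); last first.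
  exists weight0; split; first by rewrite card_unit.
    move=> c; have [i [h _]] := GH (fun _ => i1); exists i.
    have := TH i; case: (T i) => [f [B HB _]|F HF] /=.
      have /card_gt0P[x _] := wvert_gt0 f.
      by have := G0 (h (ecast z (gvert z) (esym HB) (inl x))).
    have F0 (y : F) : False.
      by have := G0 (h (ecast z (gvert z) (esym HF) y)).
    by exists finset.set0; split=> [x|]; [case: (F0 x)|exists (fun _ => tt);
      split=> [x|A _ [y]]; [case: (F0 x)|case: (F0 y)]].
  rewrite /wsize big1 ?mul0r; first by rewrite addr_ge0 // mulr_ge0 // addr_ge0.
  by move=> A _; rewrite mul0r.
(* The vertex [x0] makes [L] nonempty, as the vertex set of a weight must be; the strict inequality
   [2 * C / d < l] leaves room for it. *)
pose L : {set G} := x0 |: [set z | d * n%:R <= #|gnbr z|%:R].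
have x0L : x0 \in L by rewrite !inE eqxx.
have Ll : (#|L| <= l)%N.
  apply: leq_trans (leq_card_setU _ _) _; rewrite cards1 add1n.
  rewrite -(ltr_nat R); apply: le_lt_trans lC.
  rewrite ler_pdivlMr // -(ler_pM2r n0) -mulrA.
  apply: (@le_trans _ _ (2 * gsize G)%:R); last first.
    by rewrite natrM -mulrA ler_wpM2l.
  apply: (@le_trans _ _ (\sum_(z : G) #|gnbr z|)%:R); last first.
    by rewrite ler_nat sum_card_gnbr.
  rewrite natr_sum mulr_natl -sumr_const.
  rewrite [leRHS](bigID (fun z => z \in [set z | d * n%:R <= #|gnbr z|%:R])) /=.
  rewrite -[leLHS]addr0; apply: lerD; last by apply: sumr_ge0.
  by apply: ler_sum => z; rewrite inE.
pose V : finType := {x : G | x \in L}.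
have cardV : #|{: V}| = #|L| by rewrite card_sig; apply: eq_card.
pose K' : R := K%:R * (l%:R + e).
pose P : R := ((2 ^ l) ^ r)%:R * (K' + 1).
have K'_ge0 : 0 <= K' by rewrite mulr_ge0 // addr_ge0.
have P_ge0 : 0 <= P by rewrite mulr_ge0 // addr_ge0.
have PD : #|{: disjoint_tuple r V}|%:R * (K' + 1) <= P.
  by rewrite ler_wpM2r ?addr_ge0 // ler_nat card_disjoint_tuple // cardV.
pose x0' : {x : G | x \in L} := exist _ x0 x0L.
have KP : ((2 ^ l) ^ r)%:R * (K' + 1) <=
    ((2 ^ l) ^ r * (K * l + K + 1))%:R * (1 + e).
  rewrite natrM -mulrA ler_wpM2l // /K' !natrD natrM.
  have : 0 <= K%:R * l%:R * e :> R by rewrite !mulr_ge0.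
  have : 0 <= K%:R :> R by [].
  nra.
exists (trace_weight (n := n) L x0' P_ge0); split.
- by rewrite /= cardV.
- move=> c.
  have [sigma [sigma_cup sigma_quota]] :=
    trace_split L x0' n_gt0 K'_ge0 P_ge0 c PD.
  have [i cpi] := GH (trace_col L sigma i1); exists i.
  have := TK i; have := Td i; have := TH i.
  case Ti: (T i) => [f|F] /=.
    move=> [B HB Be] [deg_f pos_f] fK; rewrite HB in cpi.
    have Bf A : f A * n%:R - e <= #|bpart B A|%:R.
      by have := (Be A).2; rewrite ler_norml => /andP[+ _]; lra.
    have fKR : 2 ^+ #|wvert f| <= K%:R :> R by rewrite -natrX ler_nat.
    have LlR : #|L|%:R <= l%:R :> R by rewrite ler_nat.
    apply: (weight_trace L x0' n_gt0 K'_ge0 P_ge0 c sigma sigma_cup sigma_quota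
      i1 i f B e (d * n%:R)) => //.
    + by apply: ler_pM; rewrite ?exprn_ge0 ?addr_ge0 // lerD2r.
    + by move=> z; rewrite !inE negb_or -ltNge => /andP[].
    + move=> x; apply: le_trans (card_badj_ge x e_ge0 Bf).
      have : 2 ^+ #|wvert f| * e <= K%:R * e by rewrite ler_wpM2r.
      have : 2 * d * n%:R <= wdeg x * n%:R by rewrite ler_wpM2r.
      lra.
    + move=> A /pos_f dA; have : d * n%:R <= f A * n%:R by rewrite ler_wpM2r.
      lra.
  move=> HF _ _; rewrite HF in cpi.
  apply: (graph_trace L x0' n_gt0 K'_ge0 P_ge0 c sigma sigma_cup sigma_quota i1)
    cpi.
  by apply/eqP => ei; rewrite ei Ti1 in Ti.
- apply: le_trans (wsize_trace_weight _ _ n_gt0 _) _.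
  rewrite lerD2l [in leRHS]natrM -[leRHS]mulrA.
  apply: ler_pM => //; rewrite ler_nat leq_mul //.
  by rewrite leq_pexp2l.
Qed.

(** * The asymptotics *)

Definition target_mass {R : realType} (T : weight R + sgraph) : R :=
  if T is inl f then \sum_A f A else 0.

Lemma target_mass_ge0 {R : realType} (T : weight R + sgraph) :
  0 <= target_mass T.
Proof. by case: T => //= f; apply: sumr_ge0 => A _; exact: wval_ge0. Qed.

(** * Existence of an arrowing weight *)

Lemma injection_into_set {X V : finType} (S : {set V}) : (#|X| <= #|S|)%N ->
  exists h : X -> V, injective h /\ forall x, h x \in S.
Proof.
move=> XS.
have cardS : #|{: {y : V | y \in S}}| = #|S|.
  by rewrite card_sig; apply: eq_card.
have [i|phi [phi_inj _]] := @label_injection X {y : V | y \in S} unit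
    (fun _ => tt) (fun _ => tt).
  apply: leq_trans (max_card _) _; rewrite (leq_trans XS) // -cardS.
  by apply: eq_leq; apply: eq_card => y; rewrite !inE; case: i.
exists (fun x => val (phi x)); split=> [x y /val_inj/phi_inj //|x].
exact: valP.
Qed.

Section FullWeight.
Context {R : realType} (s : nat) {q : R} (q_ge0 : 0 <= q).

Definition full_weight_val (A : {set 'I_s.+1}) : R :=
  if A == finset.setT then q else 0.

Lemma full_weight_gt0 : (0 < #|{: 'I_s.+1}|)%N.
Proof. by rewrite card_ord. Qed.

Lemma full_weight_ge0 A : 0 <= full_weight_val A.
Proof. by rewrite /full_weight_val; case: ifP. Qed.

Definition full_weight := Weight full_weight_gt0 full_weight_ge0.
End FullWeight.

Definition target_bipartite {R : realType} (T : weight R + sgraph) : Prop :=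
  if T is inr F then bipartite F else True.

(** Two pigeonhole steps on [r * K + 1] vertices with all weight on the full set: some splitting has
    weight above [Q], and one of its parts has more than [K] vertices. That part alone has room for
    the vertices and the total mass of any target. *)
Lemma warrows_exists {R : realType} {r K : nat}
    {T : 'I_r -> weight R + sgraph} :
  (forall i, target_bound K (T i)) ->
  (forall i, target_bipartite (T i)) ->
  exists g, warrows g T.
Proof.
move=> TK Tbip; pose V : finType := 'I_(r * K).+1.
pose Q := \sum_i target_mass (T i).
have Q_ge0 : 0 <= Q by apply: sumr_ge0 => i _; exact: target_mass_ge0.
pose D := #|{: disjoint_tuple r V}|%:R : R.
have DQ : 0 <= D * Q by exact: mulr_ge0.
exists (full_weight (r * K) DQ) => c.
have [S cS] : exists2 S : disjoint_tuple r V,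
    (\bigcup_(i < r) val S i)%SET = [set: V]%SET & Q < c S.
  apply: contrapT => noS; have := wcol_gt c [set: V]%SET.
  rewrite /= /full_weight_val eqxx ltNge => /negP[].
  apply: (@le_trans _ _ (\sum_(S : disjoint_tuple r V
      | (\bigcup_(i < r) val S i)%SET == [set: V]%SET) Q)).
    apply: ler_sum => S /eqP S_T; rewrite leNgt; apply/negP => cS.
    by apply: noS; exists S.
  by rewrite sumr_const -[leLHS]mulr_natl ler_wpM2r // ler_nat max_card.
move=> QcS.
have [i Si] : exists i, (K < #|val S i|)%N.
  apply: contrapT => noi.
  have : (#|(\bigcup_(i < r) val S i)%SET| <= \sum_(i < r) #|val S i|)%N.
    by elim/big_rec2 : _ => [|i n B _ Bn]; rewrite ?cards0 //
      (leq_trans (leq_card_setU _ _)) // leq_add2l.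
  rewrite cS cardsT card_ord ltnNge => /negP[].
  apply: leq_trans (_ : \sum_(i < r) K <= _)%N; last first.
    by rewrite sum_nat_const card_ord.
  apply: leq_sum => i _; rewrite leqNgt; apply/negP => Si.
  by apply: noi; exists i.
have csubS : Q < csub c i (val S i).
  apply: lt_le_trans QcS _ => /=; rewrite /csub_val.
  by apply: ler_term_sum => // S'; exact: wcol_ge0.
exists i; have := TK i; have := Tbip i.
have : target_mass (T i) <= Q.
  by apply: (@ler_term_sum _ _ predT (fun i => target_mass (T i))) => // j;
    exact: target_mass_ge0.
case: (T i) => [f|F] /= fQ.
  move=> _ fK.
  have [|h [h_inj hS]] := @injection_into_set (wvert f) _ (val S i).
    apply: ltnW; apply: leq_trans Si; rewrite ltnS (leq_trans _ fK) //.
    by rewrite ltnW // ltn_expl.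
  apply: (@wembed_padded _ f (csub c i) h
      (fun A B => if B == val S i then f A else 0)) => //.
  - by move=> A B; case: ifP => // _; exact: wval_ge0.
  - move=> A B; case: eqP => [-> _|_]; last by rewrite ltxx.
    by apply/fintype.subsetP => _ /imsetP[x _ ->].
  - by move=> A; rewrite -big_mkcond big_pred1_eq.
  - move=> B; case: eqP => [->|_]; last by rewrite big1 // wval_ge0.
    exact: le_trans fQ (ltW csubS).
move=> [V1 bipV1] FK.
have [|h [h_inj hS]] := @injection_into_set F _ (val S i).
  exact: leq_trans FK (ltnW Si).
exists V1; split=> //; exists h; split=> [x y _ _ /h_inj //|A _ _].
exists (val S i); split; last exact: le_lt_trans csubS.
by apply/fintype.subsetP => _ /imsetP[x _ ->].
Qed.

(** * Constants attached to the targets *)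

Lemma common_lower_bound {R : realType} {I : finType} (P : I -> R -> Prop) :
  (forall i, exists2 d, 0 < d & P i d) ->
  (forall i d d', 0 < d' -> d' <= d -> P i d -> P i d') ->
  exists2 d, 0 < d & forall i, P i d.
Proof.
move=> exP monP.
have exP' i : exists d, 0 < d /\ P i d by have [d] := exP i; exists d.
have [d dP] := boolp.choice exP'.
have d_gt0 i : 0 < d i by have [] := dP i.
have m_gt0 : 0 < \big[Num.min/1]_i d i.
  by elim/big_ind: _ => [|x y x0 y0|i _]; rewrite ?lt_min ?x0 ?ltr01.
exists (\big[Num.min/1]_i d i) => // i.
by apply: monP (dP i).2 => //; exact: bigmin_le.
Qed.

Lemma target_sep_exists {R : realType} {r : nat}
    {T : 'I_r -> weight R + sgraph} :
  (forall i, target_nondeg (T i)) ->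
  exists2 d : R, 0 < d & forall i, target_sep d (T i).
Proof.
move=> Tnd; apply: common_lower_bound => [i|i d d' d'_gt0 dd'].
  have := Tnd i; case: (T i) => [f|F _] /=; last by exists 1.
  move=> f_iso.
  have [||d1 d1_gt0 d1P] := @common_lower_bound R (wvert f)
      (fun x d => 2 * d <= wdeg x).
  - move=> x; exists (wdeg x / 2); last by rewrite mulrC divfK.
    rewrite divr_gt0 // lt_def f_iso /=.
    by apply: sumr_ge0 => A _; exact: wval_ge0.
  - by move=> x d d' _ dd'; apply: le_trans; rewrite ler_pM2l.
  have [||d2 d2_gt0 d2P] := @common_lower_bound R {set wvert f}
      (fun A d => f A != 0 -> d <= f A).
  - move=> A; have [fA0|fA0] := eqVneq (f A) 0; first by exists 1.
    by exists (f A); rewrite // lt_def fA0 wval_ge0.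
  - by move=> A d d' _ dd' fd /fd; exact: le_trans.
  exists (Num.min d1 d2); first by rewrite lt_min d1_gt0.
  split=> [x|A fA]; last by rewrite ge_min d2P ?orbT.
  by apply: le_trans (d1P x); rewrite ler_pM2l // ge_min lexx.
case: (T i) => //= f [f1 f2]; split=> [x|A /f2]; last exact: le_trans.
by apply: le_trans (f1 x); rewrite ler_pM2l.
Qed.

Lemma target_bound_exists {R : realType} {r : nat}
    (T : 'I_r -> weight R + sgraph) :
  exists K, forall i, target_bound K (T i).
Proof.
exists (\sum_i
  match T i with inl f => 2 ^ #|wvert f| | inr F => #|F| end)%N => i.
by rewrite /target_bound; case E: (T i) => [f|F];
  rewrite (bigD1 i) //= E leq_addr.
Qed.

(** * The minimum and the infimum defining the Ramsey numbers *)

Lemma size_ramseyP {r : nat} {H : 'I_r -> sgraph} :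
  (exists G, garrows G H) ->
  (exists2 G, garrows G H & gsize G = size_ramsey H) /\
  forall G, garrows G H -> (size_ramsey H <= gsize G)%N.
Proof.
move=> exG; pose P m := `[< exists2 G, garrows G H & gsize G = m >].
have exP : exists m, P m.
  by have [G GH] := exG; exists (gsize G); apply/asboolP; exists G.
have [m /asboolP Pm m_min] := ex_minnP exP.
apply: (@xgetPex _ 0%N (fun m => (exists2 G, garrows G H & gsize G = m) /\
    (forall G, garrows G H -> (m <= gsize G)%N))).
exists m; split=> // G GH.
by apply: m_min; apply/asboolP; exists G.
Qed.

Lemma wsize_ge0 {R : realType} (g : weight R) : 0 <= wsize g.
Proof. by apply: sumr_ge0 => A _; rewrite mulr_ge0 ?wval_ge0. Qed.

(** One arrowing weight makes the infimum less than infinity, and sizes are non-negative, so it is a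
    real number [rho]. *)
Lemma wramseyP {R : realType} {r : nat} {T : 'I_r -> weight R + sgraph} :
  (exists g, warrows g T) ->
  exists rho : R, [/\ wramsey T = rho%:E,
    forall g, warrows g T -> rho <= wsize g
  & forall eps, 0 < eps -> exists2 g, warrows g T & wsize g < rho + eps].
Proof.
move=> [g0 g0T].
have low g : warrows g T -> (wramsey T <= (wsize g)%:E)%E.
  by move=> gT; apply: ereal_inf_lbound; exists g.
have rfin : wramsey T \is a fin_num.
  rewrite fin_numE; apply/andP; split; apply/eqP => rE.
    have : (0%:E <= wramsey T)%E.
      by apply: le_ereal_inf_tmp => _ [g _ ->]; rewrite lee_fin wsize_ge0.
    by rewrite rE.
  by have := low _ g0T; rewrite rE.
exists (fine (wramsey T)); rewrite fineK //; split=> // [g /low|eps eps_gt0].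
  by rewrite -[X in (X <= _)%E]fineK // lee_fin.
have [_ [g gT ->]] := lb_ereal_inf_adherent eps_gt0 rfin.
by rewrite -[X in (_ < X + _)%E]fineK // -EFinD lte_fin; exists g.
Qed.

(** * Sublinearity of the dilatation error *)

Local Open Scope classical_set_scope.

Lemma dil_error_littleo {R : realType} {q : nat} {f : 'I_q -> weight R}
    {Fn : forall i : 'I_q, nat -> bigraph (wvert (f i))} (eps : R) :
  (forall i, dilatation (Fn i)) -> 0 < eps ->
  \forall n \near \oo, dil_error Fn n <= eps * n%:R.
Proof.
move=> dil eps_gt0.
have allA : \forall n \near \oo, forall i (A : {set wvert (f i)}),
    `| #|bpart (Fn i n) A|%:R - f i A * n%:R | <= eps * n%:R.
  apply: filter_forall => i; apply: filter_forall => A.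
  have /eqoP/(_ _ eps_gt0) := (dil i).2 A.
  by apply: filterS => n; rewrite /= (ger0_norm (ler0n _ _)).
near=> n.
have n_all : forall i (A : {set wvert (f i)}),
    `| #|bpart (Fn i n) A|%:R - f i A * n%:R | <= eps * n%:R by near: n.
rewrite /dil_error.
apply/bigmax_leP; split=> [|i _]; first by rewrite mulr_ge0 // ltW.
by apply/bigmax_leP; split=> [|A _]; [rewrite mulr_ge0 // ltW|exact: n_all].
Unshelve. all: by end_near.
Qed.

Lemma dil_error_small {R : realType} {q : nat} {f : 'I_q -> weight R}
    {Fn : forall i : 'I_q, nat -> bigraph (wvert (f i))} (c tau : R) :
  (forall i, dilatation (Fn i)) -> 0 <= c -> 0 < tau ->
  \forall n \near \oo, c * (1 + dil_error Fn n) <= tau * n%:R.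
Proof.
move=> dil c_ge0 tau_gt0.
(* Both 1 and the error are eventually at most [eps * n], hence the factor 2; [c + 1] avoids
   division by 0. *)
pose eps := tau / (2 * (c + 1)).
have c1 : 0 < 2 * (c + 1) by lra.
have eps_gt0 : 0 < eps by rewrite divr_gt0.
have epsE : 2 * (c + 1) * eps = tau by rewrite /eps mulrC divfK // gt_eqF.
near=> n.
have en : dil_error Fn n <= eps * n%:R.
  by near: n; exact: dil_error_littleo.
have n1 : 1 <= eps * n%:R.
  rewrite mulrC -ler_pdivrMr // div1r; near: n.
  exists (Num.truncn eps^-1).+1 => // n /= nE.
  by rewrite ltW // (lt_le_trans (truncnS_gt _)) // ler_nat.
rewrite -epsE; have := ler_wpM2l c_ge0 en; have := ler_wpM2l c_ge0 n1; nra.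
Unshelve. all: by end_near.
Qed.

Definition sublinear {R : realType} (e : nat -> R) :=
  forall c tau : R, 0 <= c -> 0 < tau ->
    \forall n \near \oo, c * (1 + e n) <= tau * n%:R.

Lemma near_gt0 : \forall n \near \oo, (0 < n)%N.
Proof. by exists 1%N. Qed.

Lemma near_exists (P : nat -> Prop) :
  (\forall n \near \oo, P n) -> exists n, P n.
Proof. by move=> [N _ PN]; exists N; apply: PN => /=. Qed.

(** * The two-sided estimate *)

(** [rho] and [M] are fixed before [H] and [e]: the constants of both translations depend only on
    the targets once the number of vertices is bounded by [l]. *)
Lemma size_ramsey_near {R : realType} {r : nat} {T : 'I_r -> weight R + sgraph}
    {i1 : 'I_r} {f1 : weight R} :
  T i1 = inl f1 -> (forall i, target_nondeg (T i)) ->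
  (forall i, target_bipartite (T i)) ->
  exists rho M : R, [/\ wramsey T = rho%:E, 0 <= M &
    forall (H : nat -> 'I_r -> sgraph) (e : nat -> R),
    (forall n, 0 <= e n) -> sublinear e ->
    (forall n i, realizes n (e n) (T i) (H n i)) ->
    \forall n \near \oo,
      rho * n%:R - M * (1 + e n) <= (size_ramsey (H n))%:R /\
      (size_ramsey (H n))%:R <= rho * n%:R + M * (1 + e n)].
Proof.
move=> Ti1 Tnd Tbip.
have [K TK] := target_bound_exists T.
have [d d_gt0 Td] := target_sep_exists Tnd.
have [g0 g0T] := warrows_exists TK Tbip.
have [rho [rhoE rho_le rho_inf]] := wramseyP (ex_intro _ g0 g0T).
(* As [rho <= wsize g0], the bound [C * n] leaves room for weights of size up to [rho + 1/2] and a
   translation error of [n / 2]. *)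
have [C CE] : exists C, C = wsize g0 + 1 by exists (wsize g0 + 1).
have C_ge0 : 0 <= C by rewrite CE addr_ge0 ?wsize_ge0.
have [l lC] : exists l : nat, 2 * C / d < l%:R.
  by exists (Num.truncn (2 * C / d)).+1; exact: truncnS_gt.
have [MU MU_ge0 to_graph] : exists2 MU : nat -> R, forall k, 0 <= MU k &
    forall k (g : weight R) n e (H : 'I_r -> sgraph),
      (#|wvert g| <= k)%N -> warrows g T -> (0 < n)%N -> 0 <= e ->
      (forall i, realizes n e (T i) (H i)) ->
      exists2 G, garrows G H &
        (gsize G)%:R <= wsize g * n%:R + MU k * (1 + e).
  exists (fun k => (2 ^ k * k * ((2 ^ k) ^ r * K + 1))%:R) => // k g n e H.
  exact: weight_to_graph TK Tnd.
have [ML ML_ge0 to_weight] : exists2 ML : R, 0 <= ML &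
    forall n e (H : 'I_r -> sgraph) G, (0 < n)%N -> 0 <= e ->
      K%:R * e <= d * n%:R -> l%:R + e < d * n%:R ->
      (forall i, realizes n e (T i) (H i)) -> garrows G H ->
      (gsize G)%:R <= C * n%:R ->
      exists g : weight R, [/\ (#|wvert g| <= l)%N, warrows g T &
        wsize g * n%:R <= (gsize G)%:R + ML * (1 + e)].
  exists (2 ^ l * l * ((2 ^ l) ^ r * (K * l + K + 1)))%:R => // n e H G.
  exact: graph_to_weight TK Td Ti1 d_gt0 lC.
(* [MU l] pays for the upper bound, [ML] for the lower one, and 1 for using a weight that is only
   optimal up to [1 / n]. *)
exists rho, (MU l + ML + 1); split=> //; first by rewrite !addr_ge0.
move=> H e e_ge0 e_sub HT.
have upper n g : (0 < n)%N -> warrows g T ->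
    exists2 G, garrows G (H n) &
      (gsize G)%:R <= wsize g * n%:R + MU #|wvert g| * (1 + e n).
  by move=> n_gt0 gT; exact: to_graph.
have lower : \forall n \near \oo, forall G, garrows G (H n) ->
    (gsize G)%:R <= C * n%:R ->
    exists g : weight R, [/\ (#|wvert g| <= l)%N, warrows g T &
      wsize g * n%:R <= (gsize G)%:R + ML * (1 + e n)].
  near=> n => G GH GC.
  have n_gt0 : (0 < n)%N by near: n; exact: near_gt0.
  have K1 : K%:R * (1 + e n) <= d * n%:R by near: n; exact: e_sub.
  have l1 : (l%:R + 1) * (1 + e n) <= d * n%:R.
    by near: n; apply: e_sub => //; rewrite addr_ge0.
  apply: (to_weight n (e n) (H n)) => //.
    by apply: le_trans K1; rewrite ler_wpM2l // lerDr.
  have : 0 <= l%:R * e n by exact: mulr_ge0.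
  lra.
have cheap g : warrows g T -> wsize g <= rho + 2^-1 -> \forall n \near \oo,
    wsize g * n%:R + MU #|wvert g| * (1 + e n) <= C * n%:R.
  move=> gT gs; near=> n.
  have : MU #|wvert g| * (1 + e n) <= 2^-1 * n%:R.
    by near: n; apply: e_sub => //; rewrite invr_gt0.
  have : wsize g * n%:R <= (rho + 2^-1) * n%:R by rewrite ler_wpM2r.
  have : rho * n%:R <= wsize g0 * n%:R by rewrite ler_wpM2r ?rho_le.
  by rewrite CE; lra.
(* Nearly optimal weights exist on at most [l] vertices: go to a graph and
   back at a large scale. *)
have compact eps : 0 < eps -> exists g : weight R,
    [/\ (#|wvert g| <= l)%N, warrows g T & wsize g <= rho + eps].
  (* Half of [eps] goes to the choice of [g] and half to the two translations; the cap at 1/2 makes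
     [cheap] applicable. *)
  move=> eps_gt0; pose eta := Num.min (eps / 2) 2^-1.
  have eta_gt0 : 0 < eta by rewrite lt_min divr_gt0 //= invr_gt0.
  have eta_eps : eta <= eps / 2 by rewrite ge_min lexx.
  have eta_half : eta <= 2^-1 by rewrite ge_min lexx orbT.
  have [g gT gs] := rho_inf _ eta_gt0.
  have [n [n_gt0 [n_lower [n_cheap n_err]]]] : exists n, (0 < n)%N /\
      (forall G, garrows G (H n) -> (gsize G)%:R <= C * n%:R ->
        exists g : weight R, [/\ (#|wvert g| <= l)%N, warrows g T &
        wsize g * n%:R <= (gsize G)%:R + ML * (1 + e n)]) /\
      wsize g * n%:R + MU #|wvert g| * (1 + e n) <= C * n%:R /\
      (MU #|wvert g| + ML) * (1 + e n) <= (eps / 2) * n%:R.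
    apply: near_exists; near=> n; split; first by near: n; exact: near_gt0.
    split; first by near: n; exact: lower.
    split; near: n; first by apply: cheap gT _; lra.
    by apply: e_sub; rewrite ?addr_ge0 ?divr_gt0.
  have n0 : 0 < n%:R :> R by rewrite ltr0n.
  have [G GH GS] := upper n g n_gt0 gT.
  have [g' [g'l g'T g's]] := n_lower G GH (le_trans GS n_cheap).
  exists g'; split=> //; rewrite -(ler_pM2r n0).
  have : wsize g * n%:R <= (rho + eps / 2) * n%:R by rewrite ler_wpM2r //; lra.
  lra.
have [|g1 g1T g1s] := rho_inf 2^-1; first by rewrite invr_gt0.
near=> n.
have n_gt0 : (0 < n)%N by near: n; exact: near_gt0.
have n0 : 0 < n%:R :> R by rewrite ltr0n.
have n_lower : forall G, garrows G (H n) -> (gsize G)%:R <= C * n%:R ->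
    exists g : weight R, [/\ (#|wvert g| <= l)%N, warrows g T &
      wsize g * n%:R <= (gsize G)%:R + ML * (1 + e n)] by near: n.
have n_cheap : wsize g1 * n%:R + MU #|wvert g1| * (1 + e n) <= C * n%:R.
  by near: n; apply: cheap g1T (ltW g1s).
have [G1 G1H G1s] := upper n g1 n_gt0 g1T.
have exG : exists G, garrows G (H n) by exists G1.
have [[G GH Gsize] G_min] := size_ramseyP exG.
have e1 : 0 <= 1 + e n by rewrite addr_ge0.
split.
  (* A minimal arrowing graph has no more edges than [G1], which is cheap, so it can be translated
     back to a weight. *)
  have GC : (gsize G)%:R <= C * n%:R.
    rewrite Gsize; apply: le_trans (le_trans G1s n_cheap).
    by rewrite ler_nat G_min.
  have [g [_ gT gs]] := n_lower G GH GC.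
  have := ler_wpM2r (ltW n0) (rho_le g gT); rewrite -Gsize.
  have : 0 <= MU l * (1 + e n) by exact: mulr_ge0.
  lra.
(* The loss [1 / n] becomes 1 after scaling. The weight may vary with [n], but it has at most [l]
   vertices, so the error constant is always [MU l]. *)
have [|g [gl gT gs]] := compact n%:R^-1; first by rewrite invr_gt0.
have [G' G'H G's] := to_graph _ _ _ _ _ gl gT n_gt0 (e_ge0 n) (HT n).
have : (size_ramsey (H n))%:R <= (gsize G')%:R :> R by rewrite ler_nat G_min.
have := ler_wpM2r (ltW n0) gs; rewrite mulrDl mulVf ?gt_eqF //.
have : 0 <= ML * (1 + e n) by exact: mulr_ge0.
have := e_ge0 n; lra.
Unshelve. all: by end_near.
Qed.

Lemma realizes_famcat {R : realType} {r q : nat} (hqr : (q <= r)%N)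
    {f : 'I_q -> weight R} {F : 'I_(r - q) -> sgraph}
    {Fn : forall i : 'I_q, nat -> bigraph (wvert (f i))} :
  (forall i, dilatation (Fn i)) -> forall n i,
  realizes n (dil_error Fn n)
    (famcat hqr (fun i => inl (f i)) (fun k => inr (F k)) i)
    (famcat hqr (fun i => bg_graph (Fn i n)) F i).
Proof.
move=> dil n i; rewrite /famcat; case: split => [j|k] //=.
exists (Fn j n) => // A; split; first exact: (dil j).1.
by apply: le_trans (le_bigmax _ _ j); exact: (le_bigmax _ _ A).
Qed.

Theorem theorem5 (R : realType) (r q : nat) (hq : (1 <= q)%N) (hqr : (q <= r)%N)
    (f : 'I_q -> weight R) (F : 'I_(r - q) -> sgraph)
    (hf : forall i, w_no_isolated (f i))
    (hFbip : forall i, bipartite (F i))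
    (hF : forall i, g_no_isolated (F i)) :
  exists M : R,
  forall Fn : forall i : 'I_q, nat -> bigraph (wvert (f i)),
  (forall i, dilatation (Fn i)) ->
  let rhat := wramsey (famcat hqr (fun i => inl (f i)) (fun k => inr (F k))) in
  let rhat_n (n : nat) : nat :=
    size_ramsey (famcat hqr (fun i => bg_graph (Fn i n)) F) in
  (\forall n \near \oo,
     (rhat * n%:R%:E - (M * (1 + dil_error Fn n))%:E <= (rhat_n n)%:R%:E)%E /\
     ((rhat_n n)%:R%:E <= rhat * n%:R%:E + (M * (1 + dil_error Fn n))%:E)%E) /\
  (exists l : R, ((rhat_n n)%:R / n%:R : R) @[n --> \oo] --> l).
Proof.
pose T := famcat hqr (fun i => inl (f i)) (fun k => inr (F k)).
(* Since [q] is at least 1, there is a weight target whose colour can absorb the edges not joining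
   [L] to its complement. *)
pose i1 : 'I_r := cast_ord (subnKC hqr) (lshift _ (Ordinal hq)).
have Ti1 : T i1 = inl (f (Ordinal hq)).
  by rewrite /T /famcat cast_ordK (unsplitK (inl _)).
have Tnd i : target_nondeg (T i).
  by rewrite /T /famcat; case: split => [j|k] //=; exact: hf.
have Tbip i : target_bipartite (T i).
  by rewrite /T /famcat; case: split => [j|k] //=; exact: hFbip.
have [rho [M [rhoE M_ge0 near_rho]]] := size_ramsey_near Ti1 Tnd Tbip.
exists M => Fn dil rhat rhat_n.
have err_ge0 n : 0 <= dil_error Fn n by exact: bigmax_ge_id.
have bounds : \forall n \near \oo,
    rho * n%:R - M * (1 + dil_error Fn n) <= (rhat_n n)%:R /\
    (rhat_n n)%:R <= rho * n%:R + M * (1 + dil_error Fn n).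
  apply: (near_rho (fun n => famcat hqr (fun i => bg_graph (Fn i n)) F)) => //.
    by move=> c tau; exact: dil_error_small.
  exact: realizes_famcat.
split.
  by apply: filterS bounds => n [lo up]; rewrite /rhat rhoE -!EFinM !lee_fin.
(* After division by [n] the error term tends to 0, so the limit is [rho]. *)
exists rho; apply/cvgrPdist_le => eps eps_gt0; near=> n.
have n0 : 0 < n%:R :> R by rewrite ltr0n; near: n; exact: near_gt0.
have [lo up] : rho * n%:R - M * (1 + dil_error Fn n) <= (rhat_n n)%:R /\
    (rhat_n n)%:R <= rho * n%:R + M * (1 + dil_error Fn n) by near: n.
have err : M * (1 + dil_error Fn n) <= eps * n%:R.
  by near: n; exact: dil_error_small.
rewrite -(ler_pM2r n0) -[X in _ * X <= _](gtr0_norm n0) -normrM mulrBl.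
rewrite divfK ?gt_eqF // ler_norml; apply/andP; split; lra.
Unshelve. all: by end_near.
Qed.
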